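(* Let $\mathcal{H}$ be a separable Hilbert space, let $\mathbf{A}$ and $\mathbf{M}$ be positive definite operators in closed subspaces $\mathcal{H}_{\mathbf{A}}\subset\mathcal{H}$ and $\mathcal{H}_{\mathbf{M}}\subset\mathcal{H}$, respectively (both possibly unbounded), and let $F:\mathcal{H}_{\mathbf{M}}\to\mathcal{H}_{\mathbf{A}}$ be a bounded operator. Assume that $|||F|||_{HS}<\infty$ and $\mathsf{gap}(\sigma(\mathbf{M}),\sigma(\mathbf{A}))>0$. Then there exists a unique Hilbert--Schmidt operator $T:\mathcal{H}_{\mathbf{M}}\to\mathcal{H}_{\mathbf{A}}$ such that $$(\mathbf{A}^{1/2}v,\,T\mathbf{M}^{-1/2}u)-(v,\,\mathbf{A}^{-1/2}T\mathbf{M}^{1/2}u)=(v,Fu)\qquad\text{for all } v\in\mathcal{D}(\mathbf{A}^{1/2}),\ u\in\mathcal{D}(\mathbf{M}^{1/2}),$$ and $$|||T|||_{HS}\le\frac{|||F|||_{HS}}{\mathsf{gap}(\sigma(\mathbf{M}),\sigma(\mathbf{A}))}.$$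
   Context: A positive definite operator is a (possibly unbounded) selfadjoint operator bounded below by a positive constant. $\mathcal{D}(\cdot)$ denotes the domain and $\sigma(\cdot)$ the spectrum. $|||\cdot|||_{HS}$ is the Hilbert--Schmidt norm, $|||K|||_{HS}=(\mathrm{Tr}\,K^*K)^{1/2}$ (finite exactly when $K$ is Hilbert--Schmidt). For spectra of positive definite operators, $$\mathsf{gap}(\sigma(\mathbf{M}),\sigma(\mathbf{A}))=\inf_{\mu\in\sigma(\mathbf{M}),\ \lambda\in\sigma(\mathbf{A})}\frac{|\mu-\lambda|}{\sqrt{\mu\lambda}} .$$ *)

(* Defs.v *)
From mathcomp Require Import all_boot all_order all_algebra.
From mathcomp Require Import complex.
From mathcomp Require Import all_classical all_reals all_analysis.

Set Implicit Arguments.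
Unset Strict Implicit.
Unset Printing Implicit Defensive.

Import Order.TTheory GRing.Theory Num.Theory numFieldNormedType.Exports.

Local Open Scope classical_set_scope.
Local Open Scope ring_scope.

(* A Hilbert space is a complete normed space H over R[i] with a form
   dot : {dot H for conjC} (linear in its first argument, conjugate-linear in
   its second) such that dot x x = `|x| ^+ 2.  An operator, possibly unbounded
   and only partially defined, is its graph, a set of pairs (x, A x).  Thus
   equality of operators includes equality of domains, and the relational
   inverse A^-1 and composition A \; B (B is applied first) are the inverse
   and the composite of operators with their natural domains. *)

Definition separable (T : topologicalType) :=
  exists2 D : set T, countable D & dense D.

Section Operators.
Context {R : realType} {H : completeNormedModType R[i]}.
Variable dot : {dot H for Num.conj}.
Implicit Types (V W E : set H) (A B K S : set (H * H)).

Definition closed_subspace V := closed V /\ GRing.submod_closed (mem V).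

Definition domain A : set H := fst @` A.

(* The value A x; it is 0 when x is outside the domain. *)
Definition app A (x : H) : H := xget 0 [set y | A (x, y)].

Definition linear_operator V W A :=
  [/\ A `<=` V `*` W, GRing.submod_closed (mem A)
    & forall x y z, A (x, y) -> A (x, z) -> y = z].

Definition bounded_operator V W K :=
  [/\ linear_operator V W K, domain K = V
    & exists c : R, forall x, V x -> `|app K x| <= c%:C%C * `|x|].

(* The adjoint between V and W; a graph when domain A is dense in V. *)
Definition adjoint V W A : set (H * H) :=
  [set p | [/\ W p.1, V p.2
             & forall x y, A (x, y) -> dot y p.1 = dot x p.2]].

Definition selfadjoint V A :=
  [/\ linear_operator V V A, V `<=` closure (domain A) & adjoint V V A = A].

Definition positive_definite V A :=
  selfadjoint V A /\
  exists2 c : R, 0 < c &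
    forall x, domain A x -> c%:C%C * `|x| ^+ 2 <= dot (app A x) x.

(* The graph of A - z. *)
Definition shift A (z : R[i]) : set (H * H) :=
  [set p | A (p.1, p.2 + z *: p.1)].

Definition spectrum V A : set R[i] :=
  [set z | ~ bounded_operator V V ((shift A z)^-1)%relation].

Definition is_square_root V A S :=
  [/\ selfadjoint V S, forall x, domain S x -> 0 <= dot (app S x) x
    & (S \; S)%relation = A].

(* The nonnegative selfadjoint square root is unique when A is nonnegative
   and selfadjoint, so the choice made by xget is immaterial. *)
Definition sqrt_op V A : set (H * H) := xget set0 [set S | is_square_root V A S].

Definition orthonormal_basis V E :=
  (forall e f, E e -> E f -> dot e f = (e == f)%:R) /\
  smallest closed_subspace E = V.

(* Trace over an orthonormal basis of V.  Since esum is a supremum of finite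
   sums, this is the trace only for nonnegative B, for which it is independent
   of the basis. *)
Definition trace V B : \bar R :=
  \esum_(e in xget set0 [set E | orthonormal_basis V E])
    (complex.Re (dot (app B e) e))%:E.

Definition hs_norm V W K : \bar R :=
  poweR (trace V (adjoint V W K \; K)%relation) 2^-1.

Definition hilbert_schmidt V W K :=
  bounded_operator V W K /\ (hs_norm V W K < +oo)%E.

End Operators.

(* Only the real points are used: the spectra of selfadjoint operators are
   real.  The infimum over an empty spectrum (zero space) is +oo. *)
Definition gap {R : realType} (sM sA : set R[i]) : \bar R :=
  ereal_inf [set g | exists m l : R, [/\ sM m%:C%C, sA l%:C%C
                       & g = (`|m - l| / Num.sqrt (m * l))%:E]].

(* Main.v *)
Require Import Defs.
From HB Require Import structures.
From mathcomp Require Import all_boot all_order all_algebra ring lra.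
From mathcomp Require Import complex finmap.
From mathcomp Require Import all_classical all_reals all_analysis.
Import Order.TTheory GRing.Theory Num.Theory numFieldNormedType.Exports.
Local Open Scope classical_set_scope.
Local Open Scope ring_scope.

Set Implicit Arguments.
Unset Strict Implicit.
Unset Printing Implicit Defensive.

(** Write [b = A^(-1/2)] and [n = M^(-1/2)], which are bounded, selfadjoint and
    injective.  Substituting [v = b w] and [u = n u'] in the weak equation
    turns it into the equation [T n^2 - b^2 T = b F n] between bounded
    operators (lemma [weak_equation]).  On the Hilbert space of
    Hilbert-Schmidt operators, left multiplication [L] by [b^2] and right
    multiplication [R] by [n^2] are commuting bounded selfadjoint operators, so
    the question concerns the operator [D = R - L] and the right-hand side
    [C F] with [C X = b X n], where [C^2 = L R].

    The gap enters through the inequality [g |C X| <= |D X|], that is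
    [(R - L)^2 - g^2 L R >= 0] ([commuting_form_ge]).  It holds because the
    polynomial [(r - l)^2 - g^2 l r] is nonnegative whenever [l] and [r] are
    approximate eigenvalues of [b^2] and [n^2]: then [1/l] and [1/r] lie in the
    spectra of [A] and [M], and [|m - l| / sqrt (m l)] does not change when
    both numbers are inverted ([gap_condition]).  A vector at which the form is
    negative can be split by spectral projections of [L] and then of [R]
    without losing negativity; bisection leads to a joint approximate
    eigenvalue at which the polynomial is negative.  The projection at a
    threshold comes from the square root of a positive operator
    ([sqrt_ex], [spectral_projection]).

    The inequality makes [D] injective, as [C] is, whence uniqueness
    ([sylvester_inj]).  For existence, [X |-> <C X, F>] is bounded by
    [|F| / g] times [|D X|], so the principle [riesz] yields [T] with
    [|T| <= |F| / g] and [<D X, T> = <C X, F>] for all [X], that is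
    [D T = C F] ([sylvester_ex]).

    All Hilbert space theory is developed over the reals, for the real part of
    the inner product.  The solution is complex-linear because it is unique
    ([sylvester_commutes_i]), and the orthonormal family made of the [e] and
    [i e] for a complex orthonormal basis gives the Hilbert-Schmidt norm up to
    the factor [sqrt 2], which cancels in the bound.  The same principle
    [riesz] gives adjoints, projections and the surjectivity of [A]
    ([posdef_onto]). *)

(** * Real Hilbert spaces and a minimisation principle *)

(** Completeness is stated with sequences and without a topology, so that
    closed subspaces of the ambient complex space and the space of
    Hilbert-Schmidt operators are instances at no cost.  Real scalars suffice
    throughout: positivity, adjoints and projections only see the real part of
    the inner product. *)
Record hilbert (R : realType) := Hilbert {
  hilbert_sort :> lmodType R;
  ip : hilbert_sort -> hilbert_sort -> R;
  ipC : forall x y, ip x y = ip y x;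
  ipPl : forall c x y z, ip (c *: x + y) z = c * ip x z + ip y z;
  ip_ge0 : forall x, 0 <= ip x x;
  ip_eq0 : forall x, ip x x = 0 -> x = 0;
  ip_complete : forall u : nat -> hilbert_sort,
    (forall e : R, 0 < e -> exists N, forall m n, (N <= m)%N -> (N <= n)%N ->
       Num.sqrt (ip (u m - u n) (u m - u n)) <= e) ->
    exists l, forall e : R, 0 < e -> exists N, forall n, (N <= n)%N ->
       Num.sqrt (ip (u n - l) (u n - l)) <= e }.

Section LinearMaps.
Context {R : realType} {U V : lmodType R} (f : U -> V).
Hypothesis fl : linear f.

Lemma lin0 : f 0 = 0.
Proof. by have := fl (-1) 0 0; rewrite scaler0 addr0 scaleN1r addNr. Qed.
Lemma linD x y : f (x + y) = f x + f y.
Proof. by have := fl 1 x y; rewrite !scale1r. Qed.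
Lemma linZ c x : f (c *: x) = c *: f x.
Proof. by have := fl c x 0; rewrite !addr0 lin0 addr0. Qed.
Lemma linN x : f (- x) = - f x.
Proof. by rewrite -scaleN1r linZ scaleN1r. Qed.
Lemma linB x y : f (x - y) = f x - f y.
Proof. by rewrite linD linN. Qed.
End LinearMaps.

Section Norm.
Context {R : realType} {V : hilbert R}.
Implicit Types (x y z : V) (c : R).

Definition hnorm x := Num.sqrt (ip x x).

Lemma ipDl x y z : ip (x + y) z = ip x z + ip y z.
Proof. by rewrite -[x in LHS]scale1r ipPl mul1r. Qed.
Lemma ip0l z : ip 0 z = 0.
Proof. by have := ipDl 0 0 z; rewrite addr0 => /eqP; rewrite -subr_eq subrr => /eqP. Qed.
Lemma ipZl c x z : ip (c *: x) z = c * ip x z.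
Proof. by rewrite -[_ *: _]addr0 ipPl ip0l addr0. Qed.
Lemma ipNl x z : ip (- x) z = - ip x z.
Proof. by rewrite -scaleN1r ipZl mulN1r. Qed.
Lemma ipBl x y z : ip (x - y) z = ip x z - ip y z.
Proof. by rewrite ipDl ipNl. Qed.
Lemma ipDr x y z : ip z (x + y) = ip z x + ip z y.
Proof. by rewrite !(ipC z) ipDl. Qed.
Lemma ip0r z : ip z 0 = 0.
Proof. by rewrite ipC ip0l. Qed.
Lemma ipZr c x z : ip z (c *: x) = c * ip z x.
Proof. by rewrite !(ipC z) ipZl. Qed.
Lemma ipNr x z : ip z (- x) = - ip z x.
Proof. by rewrite !(ipC z) ipNl. Qed.
Lemma ipBr x y z : ip z (x - y) = ip z x - ip z y.
Proof. by rewrite !(ipC z) ipBl. Qed.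
Definition ipE := (ipDl, ipDr, ipBl, ipBr, ipNl, ipNr, ipZl, ipZr, ip0l, ip0r).

Lemma hnorm_ge0 x : 0 <= hnorm x. Proof. exact: sqrtr_ge0. Qed.
Lemma sqr_hnorm x : hnorm x ^+ 2 = ip x x.
Proof. by rewrite sqr_sqrtr// ip_ge0. Qed.
Lemma hnorm0 : hnorm 0 = 0 :> R. Proof. by rewrite /hnorm ip0l sqrtr0. Qed.
Lemma hnorm_eq0 x : hnorm x = 0 -> x = 0.
Proof. by move=> h; apply: ip_eq0; rewrite -sqr_hnorm h expr0n. Qed.
Lemma hnormZ c x : hnorm (c *: x) = `|c| * hnorm x.
Proof.
by rewrite /hnorm ipZl ipZr mulrA -expr2 sqrtrM ?sqr_ge0// sqrtr_sqr.
Qed.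
Lemma hnormN x : hnorm (- x) = hnorm x.
Proof. by rewrite /hnorm ipNl ipNr opprK. Qed.
Lemma hnormB x y : hnorm (x - y) = hnorm (y - x).
Proof. by rewrite -hnormN opprB. Qed.

Lemma hnorm_le x c : 0 <= c -> (hnorm x <= c) = (ip x x <= c ^+ 2).
Proof. by move=> c0; rewrite -sqr_hnorm ler_sqr ?nnegrE// hnorm_ge0. Qed.

End Norm.

(** The source of Cauchy-Schwarz for every positive form: the polynomial is
    the value of the form at [x + t y]. *)
Lemma discriminant_le0 (R : realType) (a b c : R) : 0 <= a ->
  (forall t, 0 <= c + 2 * t * b + t ^+ 2 * a) -> b ^+ 2 <= a * c.
Proof.
move=> a0 H; have [a1|a1] := ltrP 0 a.
  have := H (- (b / a)).
  have -> : c + 2 * - (b / a) * b + (- (b / a)) ^+ 2 * a = (a * c - b ^+ 2) / a.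
    by field; rewrite gt_eqF.
  by rewrite pmulr_lge0 ?invr_gt0// subr_ge0.
have a2 : a = 0 by apply/eqP; rewrite eq_le a0 a1.
rewrite a2 mul0r; have [->|b0] := eqVneq b 0; first by rewrite expr0n.
have := H (- ((c + 1) / (2 * b))).
have -> : c + 2 * - ((c + 1) / (2 * b)) * b + (- ((c + 1) / (2 * b))) ^+ 2 * a = -1.
  by rewrite a2 mulr0; field.
lra.
Qed.

Section CauchySchwarz.
Context {R : realType} {V : hilbert R}.
Implicit Types (x y z : V) (c : R).

Lemma cauchy_schwarz x y : `|ip x y| <= hnorm x * hnorm y.
Proof.
rewrite -ler_sqr ?nnegrE ?mulr_ge0 ?hnorm_ge0//.
rewrite exprMn !sqr_hnorm -normrX ger0_norm ?sqr_ge0// mulrC.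
apply: discriminant_le0; first exact: ip_ge0.
move=> t; have := ip_ge0 (x + t *: y); rewrite !ipE (ipC y x).
by congr (_ <= _); ring.
Qed.

Lemma ip_le_hnorm x y : ip x y <= hnorm x * hnorm y.
Proof. exact: le_trans (ler_norm _) (cauchy_schwarz _ _). Qed.

Lemma hnormD_le x y : hnorm (x + y) <= hnorm x + hnorm y.
Proof.
rewrite hnorm_le ?addr_ge0 ?hnorm_ge0// !ipE (ipC y x) -!sqr_hnorm.
have := ip_le_hnorm x y; nra.
Qed.

Lemma hnormB_le x y : hnorm (x - y) <= hnorm x + hnorm y.
Proof. by rewrite -(hnormN y); exact: hnormD_le. Qed.

Lemma hnorm_triangle y x z : hnorm (x - z) <= hnorm (x - y) + hnorm (y - z).
Proof. by have := hnormD_le (x - y) (y - z); rewrite addrA subrK. Qed.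

Lemma hnorm_small x : (forall e : R, 0 < e -> hnorm x <= e) -> x = 0.
Proof.
move=> h; apply: hnorm_eq0; apply/eqP; rewrite eq_le hnorm_ge0 andbT.
by apply/ler_addgt0Pr => e e0; rewrite add0r h.
Qed.

Lemma parallelogram x y :
  ip (x + y) (x + y) + ip (x - y) (x - y) = 2 * (ip x x + ip y y).
Proof. by rewrite !ipE (ipC y x); ring. Qed.

Definition hcvg (u : nat -> V) l := forall e : R, 0 < e ->
  exists N, forall n, (N <= n)%N -> hnorm (u n - l) <= e.

Definition hcauchy (u : nat -> V) := forall e : R, 0 < e -> exists N, forall m n,
  (N <= m)%N -> (N <= n)%N -> hnorm (u m - u n) <= e.

Lemma hcauchy_cvg u : hcauchy u -> exists l, hcvg u l.
Proof. exact: ip_complete. Qed.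

Lemma hcvg_le u l x c N : hcvg u l ->
  (forall n, (N <= n)%N -> hnorm (u n - x) <= c) -> hnorm (l - x) <= c.
Proof.
move=> ul ux; apply/ler_addgt0Pr => e e0.
have [N1 h1] := ul e e0.
have := h1 (maxn N N1) (leq_maxr _ _); have := ux (maxn N N1) (leq_maxl _ _).
have := hnorm_triangle (u (maxn N N1)) l x; rewrite (hnormB l (u _)); lra.
Qed.

Lemma hcvg_unique u l l' : hcvg u l -> hcvg u l' -> l = l'.
Proof.
move=> h h'; apply/eqP; rewrite -subr_eq0; apply/eqP/hnorm_small => e e0.
by have [N hN] := h' e e0; apply: hcvg_le h hN.
Qed.

End CauchySchwarz.

(** Minimising [|D X|^2 - 2 phi X] yields a vector representing [phi] along
    the range of [D].  For [D] the identity this is the Riesz representation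
    theorem, for [D] an inclusion the projection theorem, and for [D] an
    unbounded symmetric operator it solves an equation weakly. *)
Lemma riesz (R : realType) (U : lmodType R) (V : hilbert R) (D : U -> V)
    (phi : U -> R) (k : R) :
  linear D -> (forall c x y, phi (c *: x + y) = c * phi x + phi y) ->
  0 <= k -> (forall X, `|phi X| <= k * hnorm (D X)) ->
  exists T : V, [/\ hnorm T <= k, forall X, ip (D X) T = phi X
    & forall e : R, 0 < e -> exists X, hnorm (D X - T) <= e].
Proof.
move=> Dl phil k0 phik.
pose J X := ip (D X) (D X) - 2 * phi X.
have Jlow X : - k ^+ 2 <= J X.
  rewrite /J -sqr_hnorm; have := ler_norm (phi X); have := phik X.
  have := sqr_ge0 (hnorm (D X) - k); rewrite sqrrB; lra.
have Jex (e : R) : 0 < e -> exists X, J X <= inf (range J) + e.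
  move=> e0; have [|_ [X _ <-]] := @inf_adherent _ (range J) e e0.
    by split; [exists (J 0), 0|exists (- k ^+ 2) => _ [X _ <-]].
  by move=> /ltW; exists X.
have Jinf X : inf (range J) <= J X.
  by apply: ge_inf; [exists (- k ^+ 2) => _ [Y _ <-]|exists X].
set m := inf _ in Jex Jinf.
have phiZ c X : phi (c *: X) = c * phi X.
  have p0 : phi 0 = 0 by have := phil (-1) 0 0; rewrite scaler0 addr0; lra.
  by have := phil c X 0; rewrite addr0 p0 addr0.
(* The midpoint of two near-minimisers cannot go below the infimum, so the
   parallelogram law forces minimising sequences to be Cauchy. *)
have Jpar X Y e : J X <= m + e -> J Y <= m + e -> ip (D X - D Y) (D X - D Y) <= 4 * e.
  move=> JX JY; have := Jinf (2^-1 *: (1 *: X + Y)); have := parallelogram (D X) (D Y).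
  rewrite /J (linZ Dl) !phiZ phil Dl !ipZl !ipZr scale1r; move: JX JY; rewrite /J; lra.
have epsgt0 n : 0 < (n.+1%:R : R)^-1 by rewrite invr_gt0.
pose u n := xget 0 [set X | J X <= m + n.+1%:R^-1].
have uP n : J (u n) <= m + n.+1%:R^-1.
  exact: (@xgetPex _ 0 [set X | J X <= m + n.+1%:R^-1] (Jex _ (epsgt0 n))).
have arch (e : R) : 0 < e -> exists N, forall n, (N <= n)%N -> n.+1%:R^-1 <= e.
  move=> e0; exists (Num.truncn e^-1) => n Nn.
  rewrite -[e in _ <= e]invrK lef_pV2 ?posrE ?invr_gt0//.
  by rewrite (le_trans (ltW (truncnS_gt _)))// ler_nat.
have uc : hcauchy (D \o u).
  move=> e e0; have [N hN] := arch (e ^+ 2 / 4) ltac:(nra).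
  exists N => p q Np Nq; rewrite hnorm_le ?(ltW e0)//=.
  have Ju r : (N <= r)%N -> J (u r) <= m + e ^+ 2 / 4.
    by move=> Nr; apply: le_trans (uP r) _; rewrite lerD2l hN.
  by have /= := Jpar _ _ _ (Ju _ Np) (Ju _ Nq); lra.
have [T HT] := hcauchy_cvg uc; exists T.
have near e : 0 < e -> exists2 X, J X <= m + e & hnorm (D X - T) <= e.
  move=> e0; have [N1 h1] := HT e e0; have [N2 h2] := arch e e0.
  exists (u (maxn N1 N2)); last exact/h1/leq_maxl.
  by apply: le_trans (uP _) _; rewrite lerD2l h2// leq_maxr.
have repr X : ip (D X) T = phi X.
  apply/eqP; rewrite -subr_eq0 -sqrf_eq0 eq_le sqr_ge0 andbT.
  suff : (ip (D X) T - phi X) ^+ 2 <= ip (D X) (D X) * 0 by rewrite mulr0.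
  apply: discriminant_le0 => [|t]; first exact: ip_ge0.
  rewrite add0r; apply/ler_addgt0Pr => e e0.
  (* The error [d] of the near-minimiser is chosen so that replacing [D Y] by
     [T] in the cross term costs at most [e] altogether. *)
  pose d := e / (1 + 2 * `|t| * hnorm (D X)).
  have tx0 : 0 <= `|t| * hnorm (D X) by rewrite mulr_ge0 ?hnorm_ge0.
  have d0 : 0 < d by rewrite divr_gt0//; lra.
  have [Y HY YT] := near d d0.
  have := Jinf (t *: X + Y).
  have -> : J (t *: X + Y) = J Y + 2 * t * (ip (D X) (D Y) - phi X) + t ^+ 2 * ip (D X) (D X).
    by rewrite /J Dl phil !ipE (ipC (D Y)); ring.
  have : t * (ip (D X) (D Y - T)) <= `|t| * hnorm (D X) * d.
    apply: le_trans (ler_norm _) _; rewrite normrM -mulrA ler_wpM2l//.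
    apply: le_trans (cauchy_schwarz _ _) _.
    by rewrite ler_wpM2l ?hnorm_ge0.
  have : d * (1 + 2 * `|t| * hnorm (D X)) = e by rewrite /d divfK// gt_eqF//; lra.
  rewrite ipBr; lra.
split => // [|e e0]; last by have [X _ hX] := near e e0; exists X.
have [/eqP->//|T0] := boolP (hnorm T == 0).
have Tpos : 0 < hnorm T by rewrite lt_def T0 hnorm_ge0.
rewrite -(ler_pM2r Tpos) -expr2.
apply/ler_addgt0Pr => e e0; pose d := e / (k + hnorm T).
have d0 : 0 < d by rewrite divr_gt0//; lra.
have [Y _ HY] := near d d0.
have de : d * (k + hnorm T) = e by rewrite /d divfK// gt_eqF//; lra.
have h1 : hnorm (D Y) <= d + hnorm T by have := hnormD_le (D Y - T) T; rewrite subrK; lra.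
have h2 : ip (D Y) T <= k * hnorm (D Y).
  by rewrite repr (le_trans (ler_norm _)).
have h3 : - (d * hnorm T) <= ip (D Y - T) T.
  have := ip_le_hnorm (T - D Y) T; rewrite (hnormB T) -(opprB (D Y)) ipNl.
  by have := ler_wpM2r (hnorm_ge0 T) HY; lra.
move: h3; rewrite ipBl -sqr_hnorm; nra.
Qed.

(** * Bounded selfadjoint operators and their square roots *)

Section BoundedOperators.
Context {R : realType}.
Implicit Types V W : hilbert R.

Definition bdd V W (f : V -> W) :=
  exists2 k : R, 0 <= k & forall x, hnorm (f x) <= k * hnorm x.

(** No linearity is asked: an everywhere defined symmetric map is linear. *)
Definition bselfadj V (f : V -> V) :=
  (forall x y, ip (f x) y = ip x (f y)) /\ bdd f.

Definition commutes (T : Type) (f g : T -> T) := forall x, f (g x) = g (f x).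

Lemma bdd_pos V W (f : V -> W) : bdd f ->
  exists2 k : R, 0 < k & forall x, hnorm (f x) <= k * hnorm x.
Proof.
move=> [k k0 fk]; exists (k + 1) => [|x]; first by lra.
by have := fk x; have := hnorm_ge0 x; lra.
Qed.

Lemma bdd_comp V W V' (f : V -> W) (g : V' -> V) : bdd f -> bdd g -> bdd (f \o g).
Proof.
move=> [k k0 fk] [l l0 gl]; exists (k * l) => [|x /=]; first exact: mulr_ge0.
by rewrite (le_trans (fk _))// -mulrA ler_wpM2l.
Qed.

Lemma bdd_lin_comb V W c (f g : V -> W) : bdd f -> bdd g -> bdd (fun x => c *: f x + g x).
Proof.
move=> [k k0 fk] [l l0 gl]; exists (`|c| * k + l) => [|x /=].
  by rewrite addr_ge0// mulr_ge0.
rewrite (le_trans (hnormD_le _ _))// hnormZ mulrDl lerD// -mulrA ler_wpM2l//.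
Qed.

Lemma ip_inj V (x y : V) : (forall z, ip x z = ip y z) -> x = y.
Proof.
move=> h; apply/eqP; rewrite -subr_eq0; apply/eqP/ip_eq0.
by rewrite ipBl h subrr.
Qed.

Lemma bselfadj_linear V (f : V -> V) : bselfadj f -> linear f.
Proof.
by move=> [fs _] c x y; apply: ip_inj => z; rewrite fs !ipE !fs.
Qed.

Lemma bselfadj_id V : bselfadj (@id V).
Proof. by split=> //; exists 1 => // x; rewrite mul1r. Qed.

Lemma bselfadj_comp V (f g : V -> V) : bselfadj f -> bselfadj g -> commutes f g -> bselfadj (f \o g).
Proof.
move=> [fs fb] [gs gb] fg; split; last exact: bdd_comp.
by move=> x y /=; rewrite fs gs -fg.
Qed.

Lemma bselfadj_lin_comb V c (f g : V -> V) : bselfadj f -> bselfadj g -> bselfadj (fun x => c *: f x + g x).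
Proof.
move=> [fs fb] [gs gb]; split; last exact: bdd_lin_comb.
by move=> x y /=; rewrite !ipE fs gs.
Qed.

Lemma eq_bselfadj V (f g : V -> V) : f =1 g -> bselfadj f -> bselfadj g.
Proof. by move=> /funext ->. Qed.

Lemma bselfadjB V (f g : V -> V) : bselfadj f -> bselfadj g -> bselfadj (fun x => f x - g x).
Proof.
move=> fs gs; apply: eq_bselfadj (bselfadj_lin_comb (-1) gs fs) => x.
by rewrite scaleN1r addrC.
Qed.

Lemma bselfadj_scale V c (f : V -> V) : bselfadj f -> bselfadj (fun x => c *: f x).
Proof.
move=> fs; apply: eq_bselfadj (bselfadj_lin_comb (c - 1) fs fs) => x.
by rewrite -[f x in X in _ + X]scale1r -scalerDl subrK.
Qed.

(** Cauchy-Schwarz for the form [ip (f x) y] applied to [x] and [f x].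
    Positivity is only assumed on the span of these two vectors, because it is
    also applied to operators that are positive on a spectral subspace only. *)
Lemma form_cs V (f : V -> V) x : linear f -> (forall x y, ip (f x) y = ip x (f y)) ->
  (forall t : R, 0 <= ip (f (t *: f x + x)) (t *: f x + x)) ->
  ip (f x) (f x) ^+ 2 <= ip (f (f x)) (f x) * ip (f x) x.
Proof.
move=> fl fs H; apply: discriminant_le0.
  apply: contrapT => /negP; rewrite -ltNge => neg.
  set a := ip (f (f x)) (f x) in neg; set b := ip (f x) (f x); set c := ip (f x) x.
  (* At this [t] the quadratic term beats the two others. *)
  pose t := 1 + (`|b| * 2 + `|c|) / - a.
  have := H t; rewrite fl !ipE -/a -/b -/c (fs (f x) x) -/b.
  have ta : t * a = a - (`|b| * 2 + `|c|).
    by rewrite /t mulrDl mul1r invrN mulrN mulNr divfK// lt_eqF.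
  have t1 : 1 <= t by rewrite lerDl divr_ge0//; lra.
  have := ler_norm b; have := ler_norm c; have := normr_ge0 b; have := normr_ge0 c.
  by have : t * (t * a) = t * a - t * (`|b| * 2 + `|c|); [rewrite ta|]; nra.
move=> t; have := H t; rewrite fl !ipE (fs (f x) x).
by congr (_ <= _); ring.
Qed.

(** The form [ip (a x) y] of a positive operator satisfies Cauchy-Schwarz,
    which turns a bound on the form into a bound on [a x]. *)
Lemma pos_bound V (a : V -> V) (k : R) : bselfadj a -> (forall x, 0 <= ip (a x) x) ->
  (forall x, hnorm (a x) <= k * hnorm x) -> forall x, ip (a x) (a x) <= k * ip (a x) x.
Proof.
move=> sa pa ak x; have := form_cs (bselfadj_linear sa) sa.1 (fun t => pa (t *: a x + x)).
have := pa x; have := ip_le_hnorm (a (a x)) (a x); have := ak (a x).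
have [/eqP|n0] := boolP (ip (a x) (a x) == 0).
  by move=> e _ _ _ _; rewrite e (ip_eq0 e) ip0l mulr0.
have pn : 0 < ip (a x) (a x) by rewrite lt_def n0 ip_ge0.
move=> h1 h2 h3 h4; rewrite -(ler_pM2l pn) -expr2.
apply: le_trans h4 _; rewrite mulrA ler_wpM2r// (le_trans h2)//.
by rewrite -sqr_hnorm expr2 mulrC -mulrA ler_wpM2l ?hnorm_ge0// mulrC.
Qed.

End BoundedOperators.

Section SquareRoot.
Context {R : realType} {V : hilbert R} (b : V -> V).
Hypotheses (sb : bselfadj b) (b1 : forall x, hnorm (b x) <= hnorm x).

Fixpoint sqrt_iter n (x : V) : V :=
  if n is n.+1 then 2^-1 *: (b x + sqrt_iter n (sqrt_iter n x)) else 0.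

(** The iteration of [sqrt_iter] for the scalar 1 in place of [b]. *)
Fixpoint scalar_iter n : R := if n is n.+1 then 2^-1 * (1 + scalar_iter n ^+ 2) else 0.

Lemma scalar_iter_bound n : 0 <= scalar_iter n <= 1.
Proof. by elim: n => [|n /andP[h1 h2]] /=; [lra|nra]. Qed.

Lemma sqrt_iter_bound n x : hnorm (sqrt_iter n x) <= scalar_iter n * hnorm x.
Proof.
have t0 m : 0 <= scalar_iter m by case/andP: (scalar_iter_bound m).
elim: n x => [|n IH] x /=; first by rewrite hnorm0 mul0r.
rewrite hnormZ ger0_norm ?invr_ge0// -mulrA ler_wpM2l ?invr_ge0//.
rewrite (le_trans (hnormD_le _ _))// mulrDl mul1r lerD// (le_trans (IH _))//.
by rewrite expr2 -mulrA ler_wpM2l.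
Qed.

Lemma sqrt_iter_bselfadj n : bselfadj (sqrt_iter n).
Proof.
have sym m : forall x y, ip (sqrt_iter m x) y = ip x (sqrt_iter m y).
  elim: m => [|m IH] x y /=; first by rewrite !ipE.
  by rewrite !ipE sb.1 !IH.
split=> //; exists (scalar_iter n); [by case/andP: (scalar_iter_bound n)|exact: sqrt_iter_bound].
Qed.

Lemma sqrt_iter_comm n q : linear q -> commutes q b -> commutes q (sqrt_iter n).
Proof.
move=> ql qb; elim: n => [|n IH] x /=; first exact: lin0.
by rewrite linZ// linD// qb !IH.
Qed.

(** The difference of squares telescopes as
    [z' (z' - z) + (z' - z) z], and the same computation holds for scalars. *)
Lemma sqrt_iter_step n x :
  hnorm (sqrt_iter n.+1 x - sqrt_iter n x) <= (scalar_iter n.+1 - scalar_iter n) * hnorm x.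
Proof.
elim: n x => [|n IH] x.
  have -> : sqrt_iter 1 x - sqrt_iter 0 x = 2^-1 *: b x by rewrite /= addr0 subr0.
  rewrite hnormZ ger0_norm ?invr_ge0//= expr0n /=; have := b1 x; lra.
have t0 m : 0 <= scalar_iter m by case/andP: (scalar_iter_bound m).
have -> : sqrt_iter n.+2 x - sqrt_iter n.+1 x =
    2^-1 *: (sqrt_iter n.+1 (sqrt_iter n.+1 x - sqrt_iter n x) +
            (sqrt_iter n.+1 (sqrt_iter n x) - sqrt_iter n (sqrt_iter n x))).
  rewrite (linB (bselfadj_linear (sqrt_iter_bselfadj _))) addrA subrK.
  by rewrite [sqrt_iter n.+2 x]/= [in LHS]/= -/(sqrt_iter n.+1 x) -scalerBr opprD addrACA subrr add0r.
rewrite hnormZ ger0_norm ?invr_ge0//.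
have -> : scalar_iter n.+2 - scalar_iter n.+1 =
   2^-1 * (scalar_iter n.+1 * (scalar_iter n.+1 - scalar_iter n) + (scalar_iter n.+1 - scalar_iter n) * scalar_iter n).
  have : scalar_iter n.+2 = 2^-1 * (1 + scalar_iter n.+1 ^+ 2) by [].
  have : scalar_iter n.+1 = 2^-1 * (1 + scalar_iter n ^+ 2) by [].
  by move: (scalar_iter n.+2) (scalar_iter n.+1) (scalar_iter n) => w u v h1 h2; nra.
rewrite -mulrA ler_wpM2l ?invr_ge0// (le_trans (hnormD_le _ _))// mulrDl lerD//.
  by rewrite (le_trans (sqrt_iter_bound _ _))// -mulrA ler_wpM2l.
rewrite (le_trans (IH _))// -mulrA ler_wpM2l// ?sqrt_iter_bound//.
by rewrite subr_ge0 /=; have := sqr_ge0 (scalar_iter n - 1); rewrite sqrrB; lra.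
Qed.

Lemma sqrt_iter_dist n k x :
  hnorm (sqrt_iter (n + k) x - sqrt_iter n x) <= (scalar_iter (n + k) - scalar_iter n) * hnorm x.
Proof.
elim: k => [|k IH]; first by rewrite addn0 !subrr hnorm0 mul0r.
rewrite addnS; have := sqrt_iter_step (n + k) x; have := IH.
by have := hnorm_triangle (sqrt_iter (n + k) x) (sqrt_iter (n + k).+1 x) (sqrt_iter n x); lra.
Qed.

Lemma scalar_iter_cauchy (e : R) : 0 < e -> exists N, forall n, scalar_iter (N + n) - scalar_iter N <= e.
Proof.
move=> e0; have supT : has_sup (range scalar_iter).
  by split; [exists (scalar_iter 0), 0%N|exists 1 => _ [n _ <-]; case/andP: (scalar_iter_bound n)].
have [_ [N _ <-] hN] := sup_adherent e0 supT.
exists N => n; have : scalar_iter (N + n) <= sup (range scalar_iter).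
  by apply: ub_le_sup; [exact: supT.2|exists (N + n)%N].
lra.
Qed.

(** A solution of [z = (b + z^2) / 2], the limit of its fixed-point iteration
    from zero.  The increments are dominated by those of the same iteration
    for the scalar 1, so the convergence is uniform on bounded sets and every
    bounded operator commuting with [b] commutes with the limit. *)
Lemma fixpoint_half_square : exists z : V -> V,
  [/\ bselfadj z, forall x, hnorm (z x) <= hnorm x, forall x, z (z x) = 2 *: z x - b x
    & forall q, linear q -> bdd q -> commutes q b -> commutes q z].
Proof.
have tau1 n : 0 <= scalar_iter n <= 1 := scalar_iter_bound n.
have unif (e : R) : 0 < e -> exists N, forall m n x, (N <= m)%N -> (N <= n)%N ->
    hnorm (sqrt_iter m x - sqrt_iter n x) <= e * hnorm x.
  move=> e0; have [N hN] := @scalar_iter_cauchy (e / 2) ltac:(lra).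
  have ZN p x : (N <= p)%N -> hnorm (sqrt_iter p x - sqrt_iter N x) <= e / 2 * hnorm x.
    move=> /subnKC <-; apply: le_trans (sqrt_iter_dist _ _ _) _.
    by rewrite ler_wpM2r ?hnorm_ge0.
  exists N => m n x Nm Nn; have := ZN _ x Nm; have := ZN _ x Nn.
  by have := hnorm_triangle (sqrt_iter N x) (sqrt_iter m x) (sqrt_iter n x); rewrite (hnormB (sqrt_iter N x)); lra.
have zex x : exists l, hcvg (sqrt_iter^~ x) l.
  apply: hcauchy_cvg => e e0; have p0 := hnorm_ge0 x.
  have [N hN] := unif (e / (1 + hnorm x)) ltac:(rewrite divr_gt0//; lra).
  exists N => m n Nm Nn; rewrite (le_trans (hN _ _ x Nm Nn))//.
  by rewrite mulrAC ler_pdivrMr; nra.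
have [z zP] := choice zex.
have zunif (e : R) : 0 < e -> exists N, forall n x, (N <= n)%N ->
    hnorm (sqrt_iter n x - z x) <= e * hnorm x.
  move=> e0; have [N hN] := unif e e0; exists N => n x Nn.
  by rewrite hnormB; apply: (hcvg_le (N := N) (zP x)) => m Nm; exact: hN.
have z1 x : hnorm (z x) <= hnorm x.
  rewrite -(subr0 (z x)); apply: (@hcvg_le _ _ (sqrt_iter^~ x) _ _ _ 0%N) => // n _.
  rewrite subr0 (le_trans (sqrt_iter_bound _ _))// ler_piMl ?hnorm_ge0//.
  by case/andP: (tau1 n).
have zsym x y : ip (z x) y = ip x (z y).
  apply/eqP; rewrite -subr_eq0 -normr_eq0 eq_le normr_ge0 andbT.
  apply/ler_addgt0Pr => e e0; rewrite add0r.
  have p0 : 0 <= hnorm x * hnorm y by rewrite mulr_ge0 ?hnorm_ge0.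
  pose d := e / (1 + 2 * (hnorm x * hnorm y)).
  have d0 : 0 < d by rewrite divr_gt0//; lra.
  have de : d * (1 + 2 * (hnorm x * hnorm y)) = e by rewrite /d divfK// gt_eqF//; lra.
  have [N hN] := zunif d d0.
  have -> : ip (z x) y - ip x (z y) = ip x (sqrt_iter N y - z y) - ip (sqrt_iter N x - z x) y.
    by rewrite !ipE (sqrt_iter_bselfadj N).1; ring.
  have h1 := cauchy_schwarz x (sqrt_iter N y - z y).
  have h2 := cauchy_schwarz (sqrt_iter N x - z x) y.
  have h3 := ler_wpM2l (hnorm_ge0 x) (hN N y (leqnn _)).
  have h4 := ler_wpM2r (hnorm_ge0 y) (hN N x (leqnn _)).
  by have := ler_normB (ip x (sqrt_iter N y - z y)) (ip (sqrt_iter N x - z x) y); lra.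
have zs : bselfadj z by split=> //; exists 1 => // x; rewrite mul1r.
have zl := bselfadj_linear zs.
exists z; split=> // [x|q ql [k k0 qk] qb x].
  suff : z x = 2^-1 *: (b x + z (z x)).
    by move: (z (z x)) => w ->; apply: ip_inj => v; rewrite !ipE; field.
  apply/eqP; rewrite -subr_eq0; apply/eqP/hnorm_small => e e0.
  have p0 := hnorm_ge0 x; pose d := e / (1 + 2 * hnorm x).
  have d0 : 0 < d by rewrite divr_gt0//; lra.
  have de : d * (1 + 2 * hnorm x) = e by rewrite /d divfK// gt_eqF//; lra.
  have [N hN] := zunif d d0.
  have h1 := hN N.+1 x (leqnSn N).
  have h2 : hnorm (sqrt_iter N (sqrt_iter N x - z x)) <= d * hnorm x.
    rewrite (le_trans (sqrt_iter_bound _ _))// (le_trans _ (hN N x (leqnn _)))//.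
    by rewrite ler_piMl ?hnorm_ge0//; case/andP: (tau1 N).
  have h3 : hnorm (sqrt_iter N (z x) - z (z x)) <= d * hnorm x.
    by rewrite (le_trans (hN N (z x) (leqnn _)))// ler_wpM2l ?(ltW d0).
  have eq : z x - 2^-1 *: (b x + z (z x)) =
      2^-1 *: (sqrt_iter N (sqrt_iter N x - z x) + (sqrt_iter N (z x) - z (z x))) - (sqrt_iter N.+1 x - z x).
    rewrite (linB (bselfadj_linear (sqrt_iter_bselfadj N))) /=.
    by apply: ip_inj => w; rewrite !ipE; ring.
  rewrite eq.
  have := hnormB_le (2^-1 *: (sqrt_iter N (sqrt_iter N x - z x) + (sqrt_iter N (z x) - z (z x)))) (sqrt_iter N.+1 x - z x).
  rewrite hnormZ ger0_norm ?invr_ge0//.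
  by have := hnormD_le (sqrt_iter N (sqrt_iter N x - z x)) (sqrt_iter N (z x) - z (z x)); lra.
apply: (@hcvg_unique _ _ (sqrt_iter^~ (q x))) => // e e0.
have [N hN] := zP x (e / (1 + k)) ltac:(rewrite divr_gt0//; lra).
exists N => n Nn; rewrite -(sqrt_iter_comm n ql qb) -(linB ql) (le_trans (qk _))//.
apply: le_trans (ler_wpM2l k0 (hN n Nn)) _.
by rewrite mulrA ler_pdivrMr; nra.
Qed.

End SquareRoot.

(** With [b = 1 - a / k] a contraction, [1 - a / k = 2 z - z^2] says that
    [(1 - z)^2 = a / k]. *)
Lemma sqrt_ex (R : realType) (V : hilbert R) (a : V -> V) :
  bselfadj a -> (forall x, 0 <= ip (a x) x) -> exists s : V -> V,
  [/\ bselfadj s, forall x, 0 <= ip (s x) x, forall x, s (s x) = a x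
    & forall q, linear q -> bdd q -> commutes q a -> commutes q s].
Proof.
move=> sa pa; have [k k0 ak] := bdd_pos sa.2; have al := bselfadj_linear sa.
pose b x := - k^-1 *: a x + x.
have sb : bselfadj b := bselfadj_lin_comb (- k^-1) sa (bselfadj_id V).
have b1 x : hnorm (b x) <= hnorm x.
  rewrite hnorm_le ?hnorm_ge0// sqr_hnorm /b !ipE (ipC x (a x)).
  have := pos_bound sa pa ak x; have := pa x; set u := ip _ x; set v := ip _ _.
  move=> u0 vu; have : k^-1 * v <= u by rewrite mulrC ler_pdivrMr// mulrC.
  have : 0 < k^-1 by rewrite invr_gt0.
  by set w := k^-1 => w0 h; nra.
have [z [sz z1 zz zq]] := fixpoint_half_square sb b1.
have zl := bselfadj_linear sz.
exists (fun x => Num.sqrt k *: (x - z x)); split.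
- exact/bselfadj_scale/bselfadjB/sz/bselfadj_id.
- move=> x; rewrite !ipE mulr_ge0 ?sqrtr_ge0// subr_ge0.
  apply: le_trans (ip_le_hnorm _ _) _; rewrite -sqr_hnorm expr2.
  by rewrite ler_wpM2r ?hnorm_ge0.
- move=> x; rewrite (linZ zl) (linB zl) zz -scalerBr scalerA -expr2 sqr_sqrtr ?ltW//.
  have -> : x - z x - (z x - (2 *: z x - b x)) = k^-1 *: a x.
    by apply: ip_inj => w; rewrite /b !ipE; ring.
  by rewrite scalerA divff ?scale1r// gt_eqF.
- move=> q ql qb qa x; rewrite (linZ ql) (linB ql) (zq q)// => y.
  by rewrite /b ql qa.
Qed.

(** * Spectral projections and joint approximate eigenvalues *)

(** Spectral projection of a selfadjoint operator at a threshold [g].  With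
    [c = a - g] and [|c|] the square root of [c^2], it is the projection onto
    the kernel of [K = |c| + c], where [c = - |c|]; the orthogonal complement
    lies in the kernel of [|c| - c], because [K (|c| - c) = 0]. *)
Lemma spectral_projection (R : realType) (V : hilbert R) (a : V -> V) (g : R) :
  bselfadj a -> exists E : V -> V,
  [/\ bselfadj E, forall x, E (E x) = E x,
      forall x, ip (a (E x)) (E x) <= g * ip (E x) (E x),
      forall x, g * ip (x - E x) (x - E x) <= ip (a (x - E x)) (x - E x)
    & forall q, bselfadj q -> commutes q a -> commutes q E].
Proof.
move=> sa; pose c x := - g *: x + a x.
have sc : bselfadj c := bselfadj_lin_comb (- g) (bselfadj_id V) sa.
have cl := bselfadj_linear sc.
have [s [ss ps s2 sq]] := sqrt_ex (bselfadj_comp sc sc (fun=> erefl))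
  (fun x => ltac:(rewrite /= sc.1; exact: ip_ge0)).
have sl := bselfadj_linear ss.
have cs : commutes c s by apply: sq => //; exact: sc.2.
pose K x := 1 *: s x + c x.
have sK : bselfadj K := bselfadj_lin_comb 1 ss sc.
have Kl := bselfadj_linear sK.
have proj x : exists T : V, (forall X, ip (K X) T = ip (K X) x) /\
    (forall e : R, 0 < e -> exists X, hnorm (K X - T) <= e).
  have [|X|T [_ h1 h2]] := @riesz _ V V K (fun X => ip (K X) x) (hnorm x) Kl _ (hnorm_ge0 x).
  - by move=> d X Y; rewrite Kl !ipE.
  - by rewrite mulrC; exact: cauchy_schwarz.
  by exists T.
have [t tP] := choice proj; pose E x := x - t x.
have KE x : K (E x) = 0.
  by apply: ip_inj => z; rewrite sK.1 ipC ipBr (tP x).1 subrr ip0l.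
have orth x z : K z = 0 -> ip (t x) z = 0.
  move=> Kz; apply/eqP; rewrite -normr_eq0 eq_le normr_ge0 andbT.
  apply/ler_addgt0Pr => e e0; rewrite add0r.
  have p0 := hnorm_ge0 z; pose d := e / (1 + hnorm z).
  have d0 : 0 < d by rewrite divr_gt0//; lra.
  have de : d * (1 + hnorm z) = e by rewrite /d divfK// gt_eqF//; lra.
  have [X hX] := (tP x).2 d d0.
  have -> : ip (t x) z = ip (t x - K X) z by rewrite ipBl sK.1 Kz ip0r subr0.
  have := cauchy_schwarz (t x - K X) z; rewrite (hnormB (t x)).
  by have := ler_wpM2r p0 hX; lra.
have Euniq x y : K y = 0 -> (forall z, K z = 0 -> ip (x - y) z = 0) -> y = E x.
  move=> Ky yo; apply/eqP; rewrite -subr_eq0; apply/eqP/ip_eq0.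
  have Kd : K (y - E x) = 0 by rewrite (linB Kl) Ky KE subrr.
  have -> : y - E x = - (x - y) + t x.
    by rewrite /E; apply: ip_inj => w; rewrite !ipE; ring.
  rewrite {1}ipDl ipNl yo ?orth ?addr0 ?oppr0//.
    by have -> : - (x - y) + t x = y - E x by rewrite /E opprB opprB addrA addrAC.
  by have -> : - (x - y) + t x = y - E x by rewrite /E opprB opprB addrA addrAC.
have xE x : x - E x = t x by rewrite /E opprB addrC subrK.
have Eip x y : ip (E x) y = ip (E x) (E y).
  by rewrite /E [in RHS]ipBr -/(E x) [ip (E x) (t y)]ipC orth ?subr0.
have Ebd x : hnorm (E x) <= hnorm x.
  have [/eqP ->|n0] := boolP (hnorm (E x) == 0); first exact: hnorm_ge0.
  have p0 : 0 < hnorm (E x) by rewrite lt_def n0 hnorm_ge0.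
  by rewrite -(ler_pM2l p0) -expr2 sqr_hnorm -Eip ip_le_hnorm.
exists E; split.
- split; last by exists 1 => // x; rewrite mul1r.
  by move=> x y; rewrite Eip ipC -Eip ipC.
- by move=> x; symmetry; apply: Euniq => [|z _]; rewrite ?KE// subrr ip0l.
- move=> x; have := congr1 (fun y => ip y (E x)) (KE x); have := ps (E x).
  by rewrite /K /c !ipE; lra.
- move=> x; rewrite xE.
  have sct : s (t x) = c (t x).
    apply/eqP; rewrite -subr_eq0; apply/eqP/ip_eq0; set w := s _ - _.
    rewrite {1}/w ipBl ss.1 sc.1 -ipBr; apply: orth.
    clearbody w; by rewrite /K (linB sl) (linB cl) s2 cs /= scale1r addrA subrK subrr.
  by have := ps (t x); rewrite sct /c !ipE; lra.
- move=> q sq' qa x; have ql := bselfadj_linear sq'.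
  have qc : commutes q c by move=> y; rewrite /c ql qa.
  have qs : commutes q s by apply: sq => //= [|y]; [exact: sq'.2|rewrite !qc].
  have qK y : q (K y) = K (q y) by rewrite /K ql qs qc.
  apply: Euniq => [|z Kz]; first by rewrite -qK KE lin0.
  by rewrite -(linB ql) sq'.1 xE orth// -qK Kz lin0.
Qed.

(** The approximate point spectrum of [T]. *)
Definition approx_eigenvalue (R : realType) (V : hilbert R) (T : V -> V) (t : R) :=
  forall e : R, 0 < e -> exists2 X, X <> 0 & hnorm (T X - t *: X) <= e * hnorm X.

Section JointSpectrum.
Context {R : realType} {V : hilbert R} (L M : V -> V).
Hypotheses (sL : bselfadj L) (sM : bselfadj M) (LM : commutes L M).

(** Restricting to selfadjoint elements avoids adjoints and keeps products of
    commuting elements in the class. *)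
Definition commutant Q := [/\ bselfadj Q, commutes Q L & commutes Q M].

(** A substitute for membership in the spectral subspace of [T] for the
    interval from [alpha] to [beta].  Quantifying over the commutant makes the
    property stable under central projections, hence under repeated
    splitting. *)
Definition localized (T : V -> V) (alpha beta : R) X := forall Q, commutant Q ->
  alpha * ip (Q X) (Q X) <= ip (T (Q X)) (Q X) <= beta * ip (Q X) (Q X).

Definition central_projection E :=
  [/\ commutant E, forall Q, commutant Q -> commutes Q E & forall x, E (E x) = E x].

Lemma commutant_id : commutant id.
Proof. by split=> //; exact: bselfadj_id. Qed.

Lemma commutant_comp Q E : commutant Q -> commutant E -> commutes Q E ->
  commutant (Q \o E).
Proof.
move=> [sQ QL QM] [sE EL EM] QE; split; first exact: bselfadj_comp.
  by move=> x /=; rewrite EL QL.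
by move=> x /=; rewrite EM QM.
Qed.

Lemma commutant_lin_comb c Q Q' : commutant Q -> commutant Q' ->
  commutant (fun x => c *: Q x + Q' x).
Proof.
move=> [sQ QL QM] [sQ' QL' QM']; split; first exact: bselfadj_lin_comb.
  by move=> x /=; rewrite QL QL' (bselfadj_linear sL).
by move=> x /=; rewrite QM QM' (bselfadj_linear sM).
Qed.

Lemma commutantL : commutant L.
Proof. by split=> // x. Qed.
Lemma commutantM : commutant M.
Proof. by split=> // x; rewrite ?LM. Qed.

Lemma commutantB Q : commutant Q -> commutant (fun x => x - Q x).
Proof.
move=> CQ; have := commutant_lin_comb (-1) CQ commutant_id.
by congr commutant; apply: funext => x /=; rewrite scaleN1r addrC.
Qed.

Lemma localized_proj T alpha beta E X : central_projection E ->
  localized T alpha beta X ->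
  localized T alpha beta (E X) /\ localized T alpha beta (X - E X).
Proof.
move=> [CE Ec _] lX; split => Q CQ.
  by have := lX _ (commutant_comp CQ CE (Ec _ CQ)).
have [sQ _ _] := CQ.
have QB : commutes Q (fun x => x - E x) by move=> x; rewrite (linB (bselfadj_linear sQ)) Ec.
exact: lX _ (commutant_comp CQ (commutantB CE) QB).
Qed.

Lemma localized_mono T alpha beta alpha' beta' X : alpha' <= alpha -> beta <= beta' ->
  localized T alpha beta X -> localized T alpha' beta' X.
Proof.
move=> aa bb lX Q CQ; have /andP[h1 h2] := lX Q CQ; have := ip_ge0 (Q X).
by move=> p; apply/andP; split; nra.
Qed.

(** On the span of the localized vector [X] the operator [f = T - (t - e)]
    satisfies [0 <= f <= 2 e], so [form_cs] bounds [f X] itself. *)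
Lemma localized_near T t (e : R) X : commutant T -> 0 < e ->
  localized T (t - e) (t + e) X -> hnorm (T X - t *: X) <= 3 * e * hnorm X.
Proof.
move=> CT e0 lX; pose f x := - (t - e) *: x + T x.
have Cf : commutant f := commutant_lin_comb _ commutant_id CT.
have [sf _ _] := Cf; have fl := bselfadj_linear sf.
have fpos (s : R) : 0 <= ip (f (s *: f X + X)) (s *: f X + X).
  have /andP[h _] := lX _ (commutant_lin_comb s Cf commutant_id).
  by move: h; rewrite /f /=; set Y := s *: _ + X; rewrite !(ipDl, ipZl) => h; lra.
have h := form_cs fl sf.1 fpos.
have h1 : ip (f (f X)) (f X) <= 2 * e * ip (f X) (f X).
  by have /andP[_] := lX _ Cf; rewrite {2}/f !(ipDl, ipZl) => h'; lra.
have h2 : ip (f X) X <= 2 * e * ip X X.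
  by have /andP[_] := lX _ commutant_id; rewrite /f /= !(ipDl, ipZl) => h'; lra.
have h3 : hnorm (f X) <= 2 * e * hnorm X.
  rewrite hnorm_le ?mulr_ge0 ?hnorm_ge0//; last by lra.
  rewrite exprMn sqr_hnorm; have p0 := ip_ge0 X; have q0 := ip_ge0 (f X).
  have [/eqP ->|n0] := boolP (ip (f X) (f X) == 0); first nra.
  have p1 : 0 < ip (f X) (f X) by rewrite lt_def n0 q0.
  rewrite -(ler_pM2l p1) -expr2 (le_trans h)//.
  have := fpos 0; rewrite scale0r add0r => h0.
  rewrite (le_trans (ler_wpM2r h0 h1))//.
  have := ler_wpM2l (ltW (mulr_gt0 e0 p1)) h2; lra.
have -> : T X - t *: X = f X - e *: X by apply: ip_inj => w; rewrite /f !ipE; ring.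
have := hnormB_le (f X) (e *: X); rewrite hnormZ gtr0_norm//; lra.
Qed.

(** Bisection: at each step the spectral projection at the midpoint splits
    the localized vectors, and one half keeps witnesses of [Phi e] for every [e]. *)
Lemma bisection T (Phi : R -> V -> Prop) : commutant T ->
  (forall Q, commutant Q -> commutes Q T) ->
  (forall e e' X, e <= e' -> Phi e X -> Phi e' X) ->
  (forall e, 0 < e -> exists X, Phi e X) ->
  (forall e E X, central_projection E -> Phi e X -> Phi e (E X) \/ Phi e (X - E X)) ->
  exists t, forall e, 0 < e -> exists2 X, Phi e X & localized T (t - e) (t + e) X.
Proof.
move=> CT cT mono ex splt; have [sT TL TM] := CT.
pose G (p : R * R) := forall e, 0 < e -> exists2 X, Phi e X & localized T p.1 p.2 X.
have step p : G p -> G (p.1, (p.1 + p.2) / 2) \/ G ((p.1 + p.2) / 2, p.2).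
  move=> Gp; set m := _ / 2.
  have [E [sE EE Elo Ehi Eq]] := spectral_projection m sT.
  have cE Q : commutant Q -> commutes Q E.
    by move=> CQ; apply: Eq (cT _ CQ); case: CQ.
  have PE : central_projection E.
    by split=> //; split=> // x; rewrite (cE _ commutantL, cE _ commutantM).
  have [?|/existsNP[e1 /not_implyP[e10 H1]]] := pselect (G (p.1, m)); first by left.
  right => e e0; pose d := Num.min e e1.
  have d0 : 0 < d by rewrite lt_min e0 e10.
  have [X PX lX] := Gp d d0.
  have [lE lE'] := localized_proj PE lX.
  have half1 : localized T p.1 m (E X).
    move=> Q CQ; have /andP[-> _] /= := lE Q CQ.
    by rewrite cE// Elo.
  have half2 : localized T m p.2 (X - E X).
    move=> Q CQ; have /andP[_ ->] /= := lE' Q CQ; have [sQ _ _] := CQ.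
    by rewrite (linB (bselfadj_linear sQ)) cE// Ehi.
  have [PX1|PX2] := splt d E X PE PX.
    exfalso; apply: H1; exists (E X) => //.
    by apply: mono PX1; rewrite ge_min lexx orbT.
  by exists (X - E X) => //; apply: mono PX2; rewrite ge_min lexx.
have [k k0 Tk] := bdd_pos sT.2.
have G0 : G (- k, k).
  move=> e e0; have [X PX] := ex e e0; exists X => // Q _ /=.
  rewrite mulNr -ler_norml (le_trans (cauchy_schwarz _ _))// -sqr_hnorm expr2 mulrA.
  by rewrite ler_wpM2r ?hnorm_ge0.
pose next p := if pselect (G (p.1, (p.1 + p.2) / 2))
               then (p.1, (p.1 + p.2) / 2) else ((p.1 + p.2) / 2, p.2).
pose s n := iter n next (- k, k).
have Gs n : G (s n).
  elim: n => // n IH; rewrite /s iterS -/(s n) /next.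
  by case: pselect => // nG; case: (step _ IH).
have len n : (s n).2 - (s n).1 = 2 * k / 2 ^+ n.
  elim: n => [|n IH]; first by rewrite /= expr0; lra.
  have -> : 2 * k / 2 ^+ n.+1 = (2 * k / 2 ^+ n) / 2 by rewrite exprS; field.
  by rewrite -IH /s iterS -/(s n) /next; case: pselect => _ /=; lra.
have len0 n : (s n).1 <= (s n).2.
  by rewrite -subr_ge0 len divr_ge0 ?exprn_ge0//; lra.
have nest n m : (s n).1 <= (s (n + m)%N).1 /\ (s (n + m)%N).2 <= (s n).2.
  elim: m => [|m [h1 h2]]; first by rewrite addn0.
  rewrite addnS /s iterS -/(s (n + m)%N) /next.
  by have := len0 (n + m)%N; case: pselect => _ /= ?; split; lra.
have lr n m : (s n).1 <= (s m).2.
  have [h1 _] := nest n m; have [_ h2] := nest m n; rewrite addnC in h2.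
  exact: le_trans h1 (le_trans (len0 _) h2).
pose S := range (fun n => (s n).1); exists (sup S) => e e0.
have [n en] : exists n, 2 * k / 2 ^+ n <= e.
  exists (Num.truncn (e^-1 * (2 * k))).+1.
  rewrite ler_pdivrMr ?exprn_gt0// -ler_pdivrMl// (le_trans (ltW (truncnS_gt _)))//.
  by rewrite -natrX ler_nat ltnW// ltn_expl.
have [X PX lX] := Gs n e e0; exists X => //; apply: localized_mono lX.
  rewrite lerBlDr (@le_trans _ _ (s n).2)//; last by have := len n; lra.
  by apply: ge_sup; [exists (s 0%N).1, 0%N|move=> _ [m _ <-]].
rewrite -lerBlDr (@le_trans _ _ (s n).1)//; first by have := len n; lra.
by apply: ub_le_sup; [exists (s 0%N).2 => _ [m _ <-]|exists n].
Qed.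

(** If the polynomial form [(M - L)^2 - g^2 L M] were somewhere negative,
    localizing a witness first for [L], then for [M] would produce
    approximate eigenvalues at which the polynomial is negative. *)
Lemma commuting_form_ge (g : R) :
  (forall l r, approx_eigenvalue L l -> approx_eigenvalue M r ->
     g ^+ 2 * (l * r) <= (r - l) ^+ 2) ->
  forall X, g ^+ 2 * ip (M X) (L X) <= ip (M X - L X) (M X - L X).
Proof.
move=> H X0; rewrite leNgt; apply/negP => neg.
have Ll := bselfadj_linear sL; have Ml := bselfadj_linear sM.
pose q X := ip (M X - L X) (M X - L X) - g ^+ 2 * ip (M X) (L X).
have X0n : 0 < ip X0 X0.
  rewrite lt_def ip_ge0 andbT; apply/eqP => /ip_eq0 e.
  by move: neg; rewrite e (lin0 Ml) (lin0 Ll) subrr !ip0l mulr0 ltxx.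
(* The splitting preserves a strict inequality with a fixed margin [kappa],
   which survives the passage to approximate eigenvectors. *)
pose kappa := - q X0 / (2 * ip X0 X0).
have k0 : 0 < kappa by rewrite divr_gt0 ?mulr_gt0// /q; lra.
pose Phi X := q X < - kappa * ip X X.
have Phi0 : Phi X0.
  rewrite /Phi /kappa; have -> : - (- q X0 / (2 * ip X0 X0)) * ip X0 X0 = q X0 / 2.
    by field; rewrite gt_eqF.
  by rewrite /q; lra.
have Phis E X : central_projection E -> Phi X -> Phi (E X) \/ Phi (X - E X).
  move=> [[sE EL EM] _ EE] PX; have El := bselfadj_linear sE.
  have pyth (u v : V) : ip u v = ip (E u) (E v) + ip (u - E u) (v - E v).
    by rewrite !ipE (sE.1 u (E v)) (sE.1 u v) EE; ring.
  have qs : q X = q (E X) + q (X - E X).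
    rewrite /q (pyth (M X - L X)) (pyth (M X)) !(linB Ml, linB Ll, linB El) !EM !EL.
    have -> : M X - L X - (M (E X) - L (E X)) = M X - M (E X) - (L X - L (E X)).
      by apply: ip_inj => w; rewrite !ipE; ring.
    ring.
  have [?|n1] := pselect (Phi (E X)); [by left|right].
  move: n1 PX; rewrite /Phi (pyth X X) qs => /negP; rewrite -leNgt; lra.
have cL Q : commutant Q -> commutes Q L by case.
have cM Q : commutant Q -> commutes Q M by case.
have [l hl] := bisection (Phi := fun _ => Phi) commutantL cL (fun _ _ _ _ h => h)
  (fun _ _ => ex_intro _ X0 Phi0) (fun _ => Phis).
have [|||r hr] := bisection (T := M)
  (Phi := fun e X => Phi X /\ localized L (l - e) (l + e) X) commutantM cM.
- move=> e e' X ee' [PX lX]; split=> //; apply: localized_mono lX; lra.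
- by move=> e e0; have [X PX lX] := hl e e0; exists X.
- move=> e E X PE [PX lX]; have [lE lE'] := localized_proj PE lX.
  by case: (Phis E X PE PX); [left|right].
have near (e : R) : 0 < e -> exists X,
    [/\ Phi X, hnorm (L X - l *: X) <= e * hnorm X & hnorm (M X - r *: X) <= e * hnorm X].
  move=> e0; have e3 : 0 < e / 3 by lra.
  have [X [PX lX] mX] := hr _ e3; exists X.
  have := localized_near commutantL e3 lX; have := localized_near commutantM e3 mX.
  by have -> : 3 * (e / 3) = e by field.
have Phin X : Phi X -> X <> 0.
  by move=> + X00; rewrite /Phi X00 /q (lin0 Ml) (lin0 Ll) subrr !ip0l !mulr0 subrr ltxx.
have := H l r.
have al : approx_eigenvalue L l.
  by move=> e /near[X [/Phin X0' hX _]]; exists X.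
have ar : approx_eigenvalue M r.
  by move=> e /near[X [/Phin X0' _ hX]]; exists X.
move=> /(_ al ar); apply/negP; rewrite -ltNge -subr_lt0.
rewrite (@le_lt_trans _ _ (- kappa)) ?oppr_lt0//.
apply/ler_addgt0Pr => e e0.
have g0 := sqr_ge0 g.
(* [D] dominates all the error terms in [key] below, which are linear or
   quadratic in [d <= 1]. *)
pose D := 1 + 4 * `|r - l| + g ^+ 2 * (`|r| + `|l| + 1).
have D0 : 0 < D by rewrite /D; have := normr_ge0 (r - l); have := normr_ge0 r; have := normr_ge0 l; nra.
pose d := Num.min 1 (e / D).
have d0 : 0 < d by rewrite lt_min ltr01 divr_gt0.
have d1 : d <= 1 by rewrite ge_min lexx.
have dD : d * D <= e by rewrite -ler_pdivlMr// ge_min lexx orbT.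
have [X [PX]] := near d d0.
set u := L X - _; set v := M X - _ => hu hv.
have eL : L X = l *: X + u by rewrite /u addrC subrK.
have eM : M X = r *: X + v by rewrite /v addrC subrK.
clearbody u v.
have Xn : 0 < ip X X.
  by rewrite lt_def ip_ge0 andbT; apply/eqP => /ip_eq0 /(Phin _ PX).
have bd (x y : V) c c' : 0 <= c -> 0 <= c' -> hnorm x <= c * hnorm X -> hnorm y <= c' * hnorm X ->
    `|ip x y| <= c * c' * ip X X.
  move=> c0 c'0 hx hy; rewrite (le_trans (cauchy_schwarz _ _))// -sqr_hnorm.
  have -> : c * c' * hnorm X ^+ 2 = (c * hnorm X) * (c' * hnorm X) by ring.
  by rewrite ler_pM ?hnorm_ge0.
have hX : hnorm X <= 1 * hnorm X by rewrite mul1r.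
have b1 := bd X u 1 d ler01 (ltW d0) hX hu.
have b2 := bd X v 1 d ler01 (ltW d0) hX hv.
have b3 := bd v u d d (ltW d0) (ltW d0) hv hu.
rewrite -(ler_pM2r Xn).
have key : q X = ((r - l) ^+ 2 - g ^+ 2 * (l * r)) * ip X X
   + 2 * (r - l) * (ip X v - ip X u) + ip (v - u) (v - u)
   - g ^+ 2 * (r * ip X u + l * ip X v + ip v u).
  rewrite /q eL eM !ipE (ipC u X) (ipC v X) (ipC u v); ring.
have t1 : - (4 * `|r - l|) * (d * ip X X) <= 2 * (r - l) * (ip X v - ip X u).
  have := ler_norm (- ((r - l) * (ip X v - ip X u))); rewrite normrN normrM.
  have := ler_wpM2l (normr_ge0 (r - l)) (le_trans (ler_normB _ _) (lerD b2 b1)); lra.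
have t2 : r * ip X u + l * ip X v + ip v u <= (`|r| + `|l| + 1) * (d * ip X X).
  have := ler_norm (r * ip X u); have := ler_norm (l * ip X v); have := ler_norm (ip v u).
  rewrite !normrM; have := ler_wpM2l (normr_ge0 r) b1; have := ler_wpM2l (normr_ge0 l) b2.
  have : d * d * ip X X <= d * ip X X by rewrite ler_wpM2r ?ip_ge0// ler_piMr ?(ltW d0).
  lra.
have h3 := ler_wpM2l g0 t2; have h4 := ler_wpM2r (ltW Xn) dD; have h5 := ip_ge0 (v - u).
have h6 := mulr_gt0 d0 Xn; move: PX; rewrite /Phi key; move: h4; rewrite /D; lra.
Qed.

End JointSpectrum.

(** * Nonnegative sums, Parseval families and subspaces as types *)

Lemma fsum_fset (R : realType) (I : choiceType) (a : I -> R) (A : set I) :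
  finite_set A -> (\sum_(i \in A) (a i)%:E = (\sum_(i <- fset_set A) a i)%R%:E)%E.
Proof. by move=> fA; rewrite fsbig_finite//= sumEFin. Qed.

Section NonnegativeSums.
Context {R : realType} {I : choiceType} (D : set I).
Implicit Types a b : I -> R.

(** Squared Hilbert-Schmidt norms are sums over possibly uncountable index
    sets; as real numbers they are accessible to linear arithmetic. *)
Definition finsum a := (forall i, 0 <= a i) /\ (\esum_(i in D) (a i)%:E < +oo)%E.

Definition rsum a : R := fine (\esum_(i in D) (a i)%:E).

Lemma esum_rsum a : finsum a -> \esum_(i in D) (a i)%:E = (rsum a)%:E.
Proof.
move=> [a0 afin]; rewrite /rsum fineK// ge0_fin_numE//.
by apply: esum_ge0 => i _; rewrite lee_fin.
Qed.

Lemma finsumP a r : (forall i, 0 <= a i) -> \esum_(i in D) (a i)%:E = r%:E ->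
  finsum a /\ rsum a = r.
Proof. by move=> a0 e; rewrite /finsum /rsum e ltry. Qed.

Lemma rsum_ge0 a : finsum a -> 0 <= rsum a.
Proof.
by move=> [a0 _]; apply: fine_ge0; apply: esum_ge0 => i _; rewrite lee_fin.
Qed.

Lemma rsumD a b : finsum a -> finsum b ->
  finsum (fun i => a i + b i) /\ rsum (fun i => a i + b i) = rsum a + rsum b.
Proof.
move=> fa fb; apply: finsumP => [i|]; first by rewrite addr_ge0 ?fa.1 ?fb.1.
under eq_esum do rewrite EFinD.
by rewrite esumD => [|i _|i _]; rewrite ?lee_fin ?fa.1 ?fb.1// !esum_rsum.
Qed.

Lemma rsum_lub a c : (forall i, 0 <= a i) ->
  (forall A, fsets D A -> \sum_(i <- fset_set A) a i <= c) ->
  finsum a /\ rsum a <= c.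
Proof.
move=> a0 ac; have h : (\esum_(i in D) (a i)%:E <= c%:E)%E.
  apply: ge_ereal_sup => _ [A AD <-]; rewrite (fsum_fset _ AD.1) lee_fin.
  exact: ac.
have fa : finsum a by split=> //; apply: le_lt_trans h (ltry _).
by split=> //; rewrite -lee_fin -esum_rsum.
Qed.

Lemma rsum_fin_le a A : finsum a -> fsets D A -> \sum_(i <- fset_set A) a i <= rsum a.
Proof.
move=> fa AD; rewrite -lee_fin -esum_rsum//; apply: esum_ge; exists A => //.
by rewrite (fsum_fset _ AD.1).
Qed.

Lemma rsum_le a b : finsum b -> (forall i, 0 <= a i) -> (forall i, a i <= b i) ->
  finsum a /\ rsum a <= rsum b.
Proof.
move=> fb a0 ab; apply: rsum_lub => // A AD.
by apply: le_trans (rsum_fin_le fb AD); apply: ler_sum.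
Qed.

Lemma rsumZ_le a c : 0 <= c -> finsum a ->
  finsum (fun i => c * a i) /\ rsum (fun i => c * a i) <= c * rsum a.
Proof.
move=> c0 fa; apply: rsum_lub => [i|A AD]; first by rewrite mulr_ge0 ?fa.1.
by rewrite -mulr_sumr ler_wpM2l// rsum_fin_le.
Qed.

Lemma eq_rsum a b : (forall i, D i -> a i = b i) -> rsum a = rsum b.
Proof. by move=> ab; congr fine; apply: eq_esum => i /ab ->. Qed.

Lemma rsumZ a c : 0 <= c -> finsum a -> rsum (fun i => c * a i) = c * rsum a.
Proof.
move=> c0 fa; have [fc h] := rsumZ_le c0 fa; apply/eqP; rewrite eq_le h /=.
have [->|cn] := eqVneq c 0; first by rewrite mul0r rsum_ge0//; case: (rsumZ_le (lexx 0) fa).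
have ci : 0 <= c^-1 by rewrite invr_ge0.
have [_] := rsumZ_le ci fc; rewrite (eq_rsum (b := a)) => [|i _]; last by rewrite mulKf.
have cp : 0 < c by rewrite lt_def cn.
by rewrite ler_pdivlMl.
Qed.

End NonnegativeSums.

Lemma esum_swap (R : realType) (I J : choiceType) (D : set I) (G : set J)
    (a : I -> J -> \bar R) : (forall i j, 0 <= a i j)%E ->
  (\esum_(i in D) \esum_(j in G) a i j = \esum_(j in G) \esum_(i in D) a i j)%E.
Proof.
have half (I' J' : choiceType) (D' : set I') (G' : set J') (b : I' -> J' -> \bar R) :
    (forall i j, 0 <= b i j)%E ->
    (\esum_(i in D') \esum_(j in G') b i j <= \esum_(j in G') \esum_(i in D') b i j)%E.
  move=> b0; apply: ge_ereal_sup => _ [A AD <-]; rewrite (fsbig_finite _ _ AD.1).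
  rewrite -esum_sum//; apply: le_esum => j _; apply: esum_ge; exists A => //.
  by rewrite (fsbig_finite _ _ AD.1).
by move=> a0; apply/eqP; rewrite eq_le !half.
Qed.

(** The Parseval identity is the only property of an orthonormal basis that
    the Hilbert-Schmidt theory below relies on. *)
Record framed (R : realType) := Framed {
  frame_space :> hilbert R;
  frame_index : choiceType;
  frame_dom : set frame_index;
  frame_vec : frame_index -> frame_space;
  parseval : forall x, \esum_(i in frame_dom) (ip x (frame_vec i) ^+ 2)%:E = (ip x x)%:E }.

(** Subspaces as types, so that a closed subspace of a Hilbert space and the
    space of Hilbert-Schmidt operators are Hilbert spaces in their own right. *)
Record subspace (R : realType) (W : lmodType R) := Subspace {
  subspace_set :> W -> Prop;
  subspace0 : subspace_set 0;
  subspaceP : forall c x y, subspace_set x -> subspace_set y -> subspace_set (c *: x + y) }.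

Section SubspaceType.
Context {R : realType} {W : lmodType R} (S : subspace W).

Record sub_type := Sub { sub_val : W; sub_prop : S sub_val }.

Lemma sub_inj (x y : sub_type) : sub_val x = sub_val y -> x = y.
Proof.
case: x y => [x px] [y py] /= e; move: py; rewrite -e => py.
by congr Sub; exact: Prop_irrelevance.
Qed.

HB.instance Definition _ := gen_eqMixin sub_type.
HB.instance Definition _ := gen_choiceMixin sub_type.

Lemma subspaceD x y : S x -> S y -> S (x + y).
Proof. by move=> Sx Sy; have := subspaceP 1 Sx Sy; rewrite scale1r. Qed.
Lemma subspaceZ c x : S x -> S (c *: x).
Proof. by move=> Sx; have := subspaceP c Sx (subspace0 S); rewrite addr0. Qed.
Lemma subspaceN x : S x -> S (- x).
Proof. by move=> Sx; rewrite -scaleN1r; exact: subspaceZ. Qed.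

Definition sub0 := Sub (subspace0 S).
Definition subD x y := Sub (subspaceD (sub_prop x) (sub_prop y)).
Definition subN x := Sub (subspaceN (sub_prop x)).
Definition subZ c x := Sub (subspaceZ c (sub_prop x)).

Lemma sub_addA : associative subD.
Proof. by move=> x y z; apply: sub_inj; exact: addrA. Qed.
Lemma sub_addC : commutative subD.
Proof. by move=> x y; apply: sub_inj; exact: addrC. Qed.
Lemma sub_add0 : left_id sub0 subD.
Proof. by move=> x; apply: sub_inj; exact: add0r. Qed.
Lemma sub_addN : left_inverse sub0 subN subD.
Proof. by move=> x; apply: sub_inj; exact: addNr. Qed.

HB.instance Definition _ := GRing.isZmodule.Build sub_type sub_addA sub_addC sub_add0 sub_addN.

Lemma sub_scaleA a b x : subZ a (subZ b x) = subZ (a * b) x.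
Proof. by apply: sub_inj; exact: scalerA. Qed.
Lemma sub_scale1 : left_id 1 subZ.
Proof. by move=> x; apply: sub_inj; exact: scale1r. Qed.
Lemma sub_scaleDr : right_distributive subZ +%R.
Proof. by move=> c x y; apply: sub_inj; exact: scalerDr. Qed.
Lemma sub_scaleDl x : {morph subZ^~ x : a b / a + b}.
Proof. by move=> a b; apply: sub_inj; exact: scalerDl. Qed.

HB.instance Definition _ := GRing.Zmodule_isLmodule.Build R sub_type
  sub_scaleA sub_scale1 sub_scaleDr sub_scaleDl.

End SubspaceType.

(** * The Hilbert space of Hilbert-Schmidt operators *)

Arguments frame_dom {R} f.
Lemma sqr_ip_le (R : realType) (V : hilbert R) (x y : V) :
  ip x y ^+ 2 <= ip x x * ip y y.
Proof.
rewrite -real_normK ?num_real// -!sqr_hnorm -exprMn.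
by rewrite ler_sqr ?nnegrE ?mulr_ge0 ?hnorm_ge0// cauchy_schwarz.
Qed.

Section Adjoints.
Context {R : realType}.

Definition adjoint_pair (V W : hilbert R) (X : V -> W) (Y : W -> V) :=
  forall u w, ip (X u) w = ip u (Y w).

Lemma adjoint_pair_sym (V W : hilbert R) (X : V -> W) (Y : W -> V) :
  adjoint_pair X Y -> adjoint_pair Y X.
Proof. by move=> XY w u; rewrite ipC -XY ipC. Qed.

Lemma adjoint_pair_linear (V W : hilbert R) (X : V -> W) (Y : W -> V) :
  adjoint_pair X Y -> linear X.
Proof. by move=> XY c x y; apply: ip_inj => z; rewrite XY !ipE !XY. Qed.

Lemma adjoint_pair_bdd (V W : hilbert R) (X : V -> W) (Y : W -> V) :
  adjoint_pair X Y -> bdd X -> bdd Y.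
Proof.
move=> XY [k k0 Xk]; exists k => // w.
have [/eqP->|n0] := boolP (hnorm (Y w) == 0); first by rewrite mulr_ge0 ?hnorm_ge0.
have p0 : 0 < hnorm (Y w) by rewrite lt_def n0 hnorm_ge0.
rewrite -(ler_pM2l p0) -expr2 sqr_hnorm -XY (le_trans (ip_le_hnorm _ _))//.
by rewrite mulrA ler_wpM2r ?hnorm_ge0// mulrC.
Qed.

Lemma adjoint_ex (V W : hilbert R) (X : V -> W) : linear X -> bdd X ->
  exists Y, adjoint_pair X Y.
Proof.
move=> Xl [k k0 Xk]; suff /choice[Y YP] : forall w, exists y, forall u, ip (X u) w = ip u y.
  by exists Y => u w; exact: YP.
move=> w; have [||||T [_ h _]] := @riesz _ V V id (fun u => ip (X u) w) (k * hnorm w).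
- by [].
- by move=> c x y; rewrite Xl !ipE.
- by rewrite mulr_ge0 ?hnorm_ge0.
- move=> u; rewrite (le_trans (cauchy_schwarz _ _))// mulrAC ler_wpM2r ?hnorm_ge0//.
by exists T.
Qed.

End Adjoints.

Section HilbertSchmidt.
Context {R : realType}.
Implicit Types V W : framed R.

Definition sq_image V (W : hilbert R) (X : V -> W) (i : frame_index V) :=
  ip (X (frame_vec i)) (X (frame_vec i)).

Lemma sq_image_ge0 V (W : hilbert R) (X : V -> W) i : 0 <= sq_image X i.
Proof. exact: ip_ge0. Qed.

(** The Hilbert-Schmidt norm does not see the difference between an operator
    and its adjoint: by the Parseval identity both are the sum of the squared
    matrix entries. *)
Lemma sq_image_adjoint V W (X : V -> W) (Y : W -> V) : adjoint_pair X Y ->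
  \esum_(i in frame_dom V) (sq_image X i)%:E = \esum_(j in frame_dom W) (sq_image Y j)%:E.
Proof.
move=> XY; under eq_esum do rewrite /sq_image -parseval.
rewrite esum_swap => [|i j]; last by rewrite lee_fin sqr_ge0.
apply: eq_esum => j _; rewrite /sq_image -parseval; apply: eq_esum => i _.
by rewrite XY ipC.
Qed.

(** The adjoint satisfies the same bound by Parseval and Cauchy-Schwarz, since
    the coefficients of [Y w] are the [ip (X e) w]. *)
Lemma hs_bound V (W : hilbert R) (X : V -> W) u : linear X -> bdd X ->
  finsum (frame_dom V) (sq_image X) ->
  ip (X u) (X u) <= rsum (frame_dom V) (sq_image X) * ip u u.
Proof.
move=> Xl Xb Xf; have [Y XY] := adjoint_ex Xl Xb.
have r0 := rsum_ge0 Xf; set r := rsum _ _ in r0 *.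
have Yw w : ip (Y w) (Y w) <= r * ip w w.
  rewrite -lee_fin -parseval.
  have [fs h] := rsumZ_le (ip_ge0 w) Xf; rewrite mulrC.
  apply: le_trans (_ : (\esum_(i in frame_dom V) (ip w w * sq_image X i)%:E <= _)%E).
    by apply: le_esum => i _; rewrite lee_fin ipC -XY mulrC; exact: sqr_ip_le.
  by rewrite (esum_rsum fs) lee_fin.
have [/eqP e|n0] := boolP (ip (X u) (X u) == 0).
  by rewrite e mulr_ge0 ?ip_ge0.
have p0 : 0 < ip (X u) (X u) by rewrite lt_def n0 ip_ge0.
rewrite -(ler_pM2l p0) -expr2 {1}XY.
have h1 := sqr_ip_le u (Y (X u)).
by have := ler_wpM2l (ip_ge0 u) (Yw (X u)); lra.
Qed.

Definition is_hs V W (X : V -> W) :=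
  [/\ linear X, bdd X & finsum (frame_dom V) (sq_image X)].

Lemma sq_image_lin_comb V (W : hilbert R) c (X Y : V -> W) i :
  sq_image (c *: X + Y) i <= 2 * (c ^+ 2 * sq_image X i) + 2 * sq_image Y i.
Proof.
rewrite /sq_image; set x := X _; set y := Y _.
have -> : (c *: X + Y) (frame_vec i) = c *: x + y by [].
by have := ip_ge0 (c *: x - y); rewrite !ipE (ipC y x); lra.
Qed.

Lemma is_hs0 V W : is_hs (0 : V -> W).
Proof.
split; first by move=> c x y; rewrite scaler0 addr0.
  by exists 0 => // x; rewrite hnorm0 mul0r.
apply: (proj1 (@rsum_lub _ _ _ _ 0 (sq_image_ge0 _) _)) => A _.
by rewrite big1// => i _; rewrite /sq_image ip0l.
Qed.

Lemma is_hsP V W c (X Y : V -> W) : is_hs X -> is_hs Y -> is_hs (c *: X + Y).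
Proof.
move=> [Xl Xb Xf] [Yl Yb Yf]; split; [|exact: bdd_lin_comb|].
  move=> d x y; rewrite [LHS]/(c *: X _ + Y _) Xl Yl.
  have -> : (c *: X + Y) x = c *: X x + Y x by [].
  have -> : (c *: X + Y) y = c *: X y + Y y by [].
  by apply: ip_inj => z; rewrite !ipE; ring.
have [f1 _] := rsumZ_le (sqr_ge0 c) Xf.
have [f2 _] := rsumZ_le (ler0n R 2) f1; have [f3 _] := rsumZ_le (ler0n R 2) Yf.
have [f4 _] := rsumD f2 f3.
by apply: (proj1 (rsum_le f4 (sq_image_ge0 _) (sq_image_lin_comb c X Y))).
Qed.

Definition hs_subspace V W := Subspace (is_hs0 V W) (@is_hsP V W).

Definition hs_type V W := sub_type (hs_subspace V W).

Definition hs_fun V W (X : hs_type V W) : V -> W := sub_val X.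
Coercion hs_fun : hs_type >-> Funclass.

Section Structure.
Variables V W : framed R.
Local Notation dom := (frame_dom V).
Implicit Types X Y : hs_type V W.

Definition hs_sq X := rsum dom (sq_image (hs_fun X)).

Lemma hs_linear X : linear (hs_fun X). Proof. by case: (sub_prop X). Qed.
Lemma hs_bdd X : bdd (hs_fun X). Proof. by case: (sub_prop X). Qed.
Lemma hs_finsum X : finsum dom (sq_image (hs_fun X)). Proof. by case: (sub_prop X). Qed.

Lemma hs_inj X Y : (forall u, X u = Y u) -> X = Y.
Proof. by move=> h; apply: sub_inj; exact: funext. Qed.

Lemma hs_addE X Y u : hs_fun (X + Y) u = X u + Y u. Proof. by []. Qed.
Lemma hs_oppE X u : hs_fun (- X) u = - X u. Proof. by []. Qed.
Lemma hs_scaleE c X u : hs_fun (c *: X) u = c *: X u. Proof. by []. Qed.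

(** Defined by polarisation, so that only sums of nonnegative terms occur. *)
Definition hs_ip X Y := (hs_sq (X + Y) - hs_sq X - hs_sq Y) / 2.

(** The tool for every inner-product identity below: after polarisation each
    of them equates sums of squared norms that already agree vector by vector. *)
Lemma hs_sq_eq (s t : seq (hs_type V W)) :
  (forall u, \sum_(Z <- s) ip (Z u) (Z u) = \sum_(Z <- t) ip (Z u) (Z u)) ->
  \sum_(Z <- s) hs_sq Z = \sum_(Z <- t) hs_sq Z.
Proof.
move=> h; have sumE r : let a i := \sum_(Z <- r) sq_image (hs_fun Z) i in
    finsum dom a /\ rsum dom a = \sum_(Z <- r) hs_sq Z.
  elim: r => [|Z r [f IH]] /=.
    apply: finsumP => [i|]; first by rewrite big_nil.
    by rewrite big_nil esum1// => i _; rewrite big_nil.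
  under eq_fun do rewrite big_cons.
  by have := rsumD (hs_finsum Z) f; rewrite IH big_cons.
by rewrite -!(sumE _).2; apply: eq_rsum => i _; exact: h.
Qed.

Lemma hs_sqZ c X : hs_sq (c *: X) = c ^+ 2 * hs_sq X.
Proof.
rewrite /hs_sq -(rsumZ (sqr_ge0 c) (hs_finsum X)); apply: eq_rsum => i _.
have -> : sq_image (hs_fun (c *: X)) i = ip (c *: X (frame_vec i)) (c *: X (frame_vec i)) by [].
by rewrite !ipE mulrA.
Qed.

Lemma hs_sq_parallelogram X Y : hs_sq (X + Y) + hs_sq (X - Y) = 2 * hs_sq X + 2 * hs_sq Y.
Proof.
have := @hs_sq_eq [:: X + Y; X - Y] [:: Num.sqrt 2 *: X; Num.sqrt 2 *: Y].
rewrite !big_cons !big_nil !addr0 !hs_sqZ sqr_sqrtr//; apply => u.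
rewrite !big_cons !big_nil !addr0 !hs_addE !hs_oppE !hs_scaleE.
by rewrite parallelogram !ipZl !ipZr !mulrA -[Num.sqrt 2 * _]expr2 sqr_sqrtr// mulrDr.
Qed.

Lemma hs_ipE X Y : hs_ip X Y = (hs_sq (X + Y) - hs_sq (X - Y)) / 4.
Proof. by rewrite /hs_ip; have := hs_sq_parallelogram X Y; lra. Qed.

Lemma hs_ipC X Y : hs_ip X Y = hs_ip Y X.
Proof. by rewrite /hs_ip (addrC X); ring. Qed.

Lemma hs_sq0 : hs_sq 0 = 0.
Proof. by rewrite -(scale0r 0) hs_sqZ expr0n mul0r. Qed.

Lemma hs_sqN X : hs_sq (- X) = hs_sq X.
Proof. by rewrite -scaleN1r hs_sqZ sqrrN expr1n mul1r. Qed.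

Lemma hs_ipNl X Y : hs_ip (- X) Y = - hs_ip X Y.
Proof. by rewrite !hs_ipE -(hs_sqN (X - Y)) -(hs_sqN (X + Y)) opprB opprD (addrC (- X) Y); ring. Qed.

Lemma hs_ipDl X Y Z : hs_ip (X + Y) Z = hs_ip X Z + hs_ip Y Z.
Proof.
have := @hs_sq_eq [:: X + Y + Z; X; Y; Z] [:: X + Y; Y + Z; X + Z].
rewrite !big_cons !big_nil !addr0 => h.
have : hs_sq (X + Y + Z) + (hs_sq X + (hs_sq Y + hs_sq Z)) = hs_sq (X + Y) + (hs_sq (Y + Z) + hs_sq (X + Z)).
  apply: h => u; rewrite !big_cons !big_nil !addr0 !hs_addE !ipE.
  by rewrite (ipC (Y u) (X u)) (ipC (Z u) (X u)) (ipC (Z u) (Y u)); ring.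
rewrite /hs_ip; lra.
Qed.

Lemma hs_ipZl c X Z : hs_ip (c *: X) Z = c * hs_ip X Z.
Proof.
wlog c0 : c X / 0 <= c => [H|].
  have [/H->//|c0] := lerP 0 c.
  by rewrite -[c]opprK scaleNr hs_ipNl H ?oppr_ge0 ?(ltW c0)//; ring.
have := @hs_sq_eq [:: c *: X + Z; Num.sqrt c *: (X - Z)] [:: c *: X - Z; Num.sqrt c *: (X + Z)].
rewrite !big_cons !big_nil !addr0 !hs_sqZ sqr_sqrtr// => h.
suff : hs_sq (c *: X + Z) + c * hs_sq (X - Z) = hs_sq (c *: X - Z) + c * hs_sq (X + Z).
  by rewrite !hs_ipE; lra.
apply: h => u; rewrite !big_cons !big_nil !addr0 !(hs_addE, hs_oppE, hs_scaleE).
rewrite !(ipZl (Num.sqrt c)) !(ipZr (Num.sqrt c)) !(mulrA (Num.sqrt c)) -[Num.sqrt c * _]expr2 sqr_sqrtr//.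
by rewrite !ipE (ipC (Z u)); ring.
Qed.

Lemma hs_ipPl c X Y Z : hs_ip (c *: X + Y) Z = c * hs_ip X Z + hs_ip Y Z.
Proof. by rewrite hs_ipDl hs_ipZl. Qed.

Lemma hs_ip_hs_sq X : hs_ip X X = hs_sq X.
Proof. by rewrite hs_ipE subrr hs_sq0 subr0 -mulr2n -scaler_nat hs_sqZ; field. Qed.

Lemma hs_ip_ge0 X : 0 <= hs_ip X X.
Proof. by rewrite hs_ip_hs_sq rsum_ge0//; exact: hs_finsum. Qed.

Lemma hs_bound_hs_sq X u : ip (X u) (X u) <= hs_sq X * ip u u.
Proof. exact: hs_bound (hs_linear X) (hs_bdd X) (hs_finsum X). Qed.

Lemma hs_ip_eq0 X : hs_ip X X = 0 -> X = 0.
Proof.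
rewrite hs_ip_hs_sq => e; apply: hs_inj => u; apply: ip_eq0.
by apply/eqP; rewrite eq_le ip_ge0 andbT (le_trans (hs_bound_hs_sq X u))// e mul0r.
Qed.

(** The norm dominates the operator norm, so a Cauchy sequence converges
    pointwise; on finitely many indices the pointwise limit is as close to
    [u n] as the Cauchy condition allows, up to the factor 2 of the
    parallelogram law, and this passes to the whole sum. *)
Lemma hs_complete (u : nat -> hs_type V W) :
    (forall e : R, 0 < e -> exists N, forall m n, (N <= m)%N -> (N <= n)%N ->
       Num.sqrt (hs_ip (u m - u n) (u m - u n)) <= e) ->
    exists l, forall e : R, 0 < e -> exists N, forall n, (N <= n)%N ->
       Num.sqrt (hs_ip (u n - l) (u n - l)) <= e.
Proof.
move=> ucau.
have nle X (e : R) : 0 <= e -> (Num.sqrt (hs_ip X X) <= e) = (hs_sq X <= e ^+ 2).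
  by move=> e0; rewrite -ler_sqr ?nnegrE ?sqrtr_ge0// sqr_sqrtr ?hs_ip_ge0// hs_ip_hs_sq.
have cau (e : R) : 0 < e -> exists N, forall m n, (N <= m)%N -> (N <= n)%N -> hs_sq (u m - u n) <= e ^+ 2.
  move=> e0; have [N hN] := ucau e e0; exists N => m n Nm Nn.
  by rewrite -nle ?(ltW e0)// hN.
have ptw x : exists l, hcvg (fun n => u n x) l.
  apply: hcauchy_cvg => e e0; have p0 := hnorm_ge0 x.
  have d0 : 0 < e / (1 + hnorm x) by rewrite divr_gt0//; lra.
  have [N hN] := cau _ d0; exists N => m n Nm Nn.
  rewrite hnorm_le ?(ltW e0)//; have := hs_bound_hs_sq (u m - u n) x.
  have -> : hs_fun (u m - u n) x = u m x - u n x by [].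
  move=> h; rewrite (le_trans h)// (le_trans (ler_wpM2r (ip_ge0 x) (hN _ _ Nm Nn)))//.
  rewrite -sqr_hnorm -exprMn ler_sqr ?nnegrE ?(ltW e0) ?(mulr_ge0 (ltW d0) p0)//.
  by rewrite mulrAC ler_pdivrMr; nra.
have [f fP] := choice ptw.
have fl : linear f.
  move=> c x y; apply: (hcvg_unique (fP _)) => e e0.
  have [d [d0 dc]] : exists d, 0 < d /\ `|c| * d + d <= e.
    exists (e / (`|c| + 1)); have := normr_ge0 c => c0; split.
      by rewrite divr_gt0//; lra.
    by rewrite -[X in _ + X]mul1r -mulrDl mulrC divfK// gt_eqF//; lra.
  have [N1 h1] := fP x d d0; have [N2 h2] := fP y d d0.
  exists (maxn N1 N2) => n; rewrite geq_max => /andP[n1 n2].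
  have -> : u n (c *: x + y) - (c *: f x + f y) = c *: (u n x - f x) + (u n y - f y).
    by rewrite hs_linear; apply: ip_inj => w; rewrite !ipE; ring.
  rewrite (le_trans (hnormD_le _ _))// (le_trans _ dc)// hnormZ lerD ?h2//.
  by rewrite ler_wpM2l// h1.
have tail (e : R) : 0 < e -> exists N, forall n, (N <= n)%N ->
    finsum dom (sq_image (fun x => u n x - f x)) /\ rsum dom (sq_image (fun x => u n x - f x)) <= e ^+ 2.
  move=> e0; have d0 : 0 < e / 2 by lra.
  have [N hN] := cau _ d0; exists N => n Nn.
  apply: rsum_lub => [i|A AD]; first exact: sq_image_ge0.
  have fin (s : seq (frame_index V)) (d : R) : 0 < d -> exists K, forall k, (K <= k)%N ->
      \sum_(i <- s) sq_image (fun x => u k x - f x) i <= d.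
    elim: s d => [|i s IH] d d0'; first by exists 0%N => k _; rewrite big_nil ltW.
    have d2 : 0 < Num.min 1 (d / 2) by rewrite lt_min ltr01; lra.
    have d3 : 0 < d / 2 by lra.
    have [K1 h1] := IH _ d3; have [K2 h2] := fP (frame_vec i) _ d2.
    exists (maxn K1 K2) => k; rewrite geq_max => /andP[k1 k2].
    rewrite big_cons [d in _ <= d](splitr d) lerD ?h1// /sq_image -sqr_hnorm.
    have := h2 k k2; rewrite le_min => /andP[a1 a2].
    by rewrite expr2 (le_trans _ a2)// ler_piMl ?hnorm_ge0.
  have e20 : 0 < e ^+ 2 / 4 by rewrite divr_gt0// exprn_gt0.
  have [K hK] := fin (fset_set A) _ e20.
  pose k := maxn K N; have := hK k (leq_maxl _ _).
  have := rsum_fin_le (hs_finsum (u n - u k)) AD.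
  have := hN n k Nn (leq_maxr _ _); rewrite -/(rsum _ _) -/(hs_sq _) => h1 h2 h3.
  apply: le_trans (_ : \sum_(i <- fset_set A)
      (2 * sq_image (hs_fun (u n - u k)) i + 2 * sq_image (fun x => u k x - f x) i) <= _).
    apply: ler_sum => i _; rewrite /sq_image; set x := frame_vec i.
    have -> : hs_fun (u n - u k) x = u n x - u k x by [].
    have -> : u n x - f x = (u n x - u k x) + (u k x - f x) by rewrite addrA subrK.
    set v := _ - _; set w := _ - _; have := ip_ge0 (v - w).
    have := parallelogram v w; lra.
  rewrite big_split /= -!mulr_sumr; move: h1 h2 h3; rewrite /hs_sq; lra.
have [N1 /(_ N1 (leqnn _))[f1 _]] := tail 1 ltr01.
have fb : bdd f.
  have gl : linear (fun x => u N1 x - f x).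
    by move=> c x y; rewrite hs_linear fl; apply: ip_inj => w; rewrite !ipE; ring.
  have [N hN] := cau 1 ltr01; pose k := 2 * hs_sq (u N) + 2.
  have k0 : 0 <= k by rewrite addr_ge0// mulr_ge0// -hs_ip_hs_sq hs_ip_ge0.
  exists (Num.sqrt k) => [|x]; first exact: sqrtr_ge0.
  rewrite -(subr0 (f x)); apply: (hcvg_le (N := N) (fP x)) => n Nn.
  rewrite subr0 hnorm_le ?mulr_ge0 ?sqrtr_ge0 ?hnorm_ge0// exprMn sqr_sqrtr// sqr_hnorm.
  rewrite (le_trans (hs_bound_hs_sq _ _))// ler_wpM2r ?ip_ge0// /k.
  have := hN n N Nn (leqnn _); have := hs_sq_parallelogram (u n - u N) (u N).
  rewrite subrK expr1n; have := hs_ip_ge0 (u n - u N - u N); rewrite hs_ip_hs_sq; lra.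
have fhs : is_hs f.
  split=> //.
  have [f2 _] := rsumZ_le (ler0n R 2) f1.
  have [f3 _] := rsumZ_le (ler0n R 2) (hs_finsum (u N1)).
  have [f4 _] := rsumD f3 f2.
  apply: (proj1 (rsum_le f4 (sq_image_ge0 _) _)) => i; rewrite /sq_image.
  set x := u N1 _; set y := f _; have := ip_ge0 (x + (x - y)).
  by rewrite !ipE (ipC y x); have := ip_ge0 (x - y); rewrite !ipE (ipC y x); lra.
exists (@Sub _ _ (hs_subspace V W) f fhs) => e e0; have [N hN] := tail e e0.
exists N => n Nn; rewrite nle ?(ltW e0)//; have [_] := hN n Nn.
by apply: le_trans; rewrite le_eqVlt; apply/orP; left; apply/eqP; apply: eq_rsum.
Qed.

Definition hs_space : hilbert R := Hilbert hs_ipC hs_ipPl hs_ip_ge0 hs_ip_eq0 hs_complete.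

End Structure.
End HilbertSchmidt.

(** * Multiplication operators and the Sylvester equation *)

Section HilbertSchmidtOperators.
Context {R : realType}.
Implicit Types V W : framed R.

Lemma hs_normE V W (X : hs_space V W) : ip X X = rsum (frame_dom V) (sq_image (hs_fun X)).
Proof. exact: hs_ip_hs_sq. Qed.

Lemma hs_funPE V W (c : R) (X Y : hs_space V W) u : hs_fun (c *: X + Y) u = c *: hs_fun X u + hs_fun Y u.
Proof. by []. Qed.

Lemma hs_adjoint_ex V W (X : hs_space V W) : exists Y : hs_space W V, adjoint_pair (hs_fun X) (hs_fun Y).
Proof.
have [Y XY] := adjoint_ex (hs_linear X) (hs_bdd X).
have YX := adjoint_pair_sym XY.
suff Yhs : is_hs Y by exists (@Sub _ _ (hs_subspace W V) Y Yhs).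
split; [exact: adjoint_pair_linear YX|exact: adjoint_pair_bdd XY (hs_bdd X)|].
by split; [exact: sq_image_ge0|rewrite -(sq_image_adjoint XY); case: (hs_finsum X)].
Qed.

Definition hs_adj V W (X : hs_space V W) : hs_space W V := projT1 (cid (hs_adjoint_ex X)).

Lemma hs_adjP V W (X : hs_space V W) : adjoint_pair (hs_fun X) (hs_fun (hs_adj X)).
Proof. by rewrite /hs_adj; case: cid. Qed.

Lemma hs_adj_uniq V W (X : hs_space V W) (Y : hs_space W V) :
  adjoint_pair (hs_fun X) (hs_fun Y) -> Y = hs_adj X.
Proof.
move=> XY; apply: hs_inj => w; apply: ip_inj => u.
by rewrite ipC -XY (hs_adjP X) ipC.
Qed.

Lemma hs_adjK V W (X : hs_space V W) : hs_adj (hs_adj X) = X.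
Proof. by apply/esym/hs_adj_uniq/adjoint_pair_sym/hs_adjP. Qed.

Lemma hs_adj_linear V W : linear (@hs_adj V W).
Proof.
move=> c X Y; apply/esym/hs_adj_uniq => u w.
by rewrite !hs_funPE !ipE (hs_adjP X) (hs_adjP Y).
Qed.

Lemma hs_adj_isometry V W (X : hs_space V W) : ip (hs_adj X) (hs_adj X) = ip X X.
Proof. by rewrite !hs_normE /rsum (sq_image_adjoint (hs_adjP X)). Qed.

Lemma hs_adj_ip V W (X Y : hs_space V W) : ip (hs_adj X) (hs_adj Y) = ip X Y.
Proof.
have := hs_adj_isometry (X + Y); rewrite (linD (@hs_adj_linear V W)) !ipE.
by rewrite !hs_adj_isometry (ipC (hs_adj Y)) (ipC Y); lra.
Qed.

Lemma hs_hnorm_le V W (X : hs_space V W) (Y : hs_space V W) (k : R) : 0 <= k ->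
  (forall u, hnorm (hs_fun X u) <= k * hnorm (hs_fun Y u)) -> hnorm X <= k * hnorm Y.
Proof.
move=> k0 h; rewrite hnorm_le ?mulr_ge0 ?hnorm_ge0// exprMn sqr_hnorm !hs_normE.
rewrite -(rsumZ (sqr_ge0 k) (hs_finsum Y)).
have [fk _] := rsumZ_le (sqr_ge0 k) (hs_finsum Y).
apply: (proj2 (rsum_le fk (sq_image_ge0 _) _)) => i.
rewrite /sq_image -!sqr_hnorm -exprMn ler_sqr ?nnegrE ?mulr_ge0 ?hnorm_ge0//; exact: h.
Qed.

Section LeftMultiplication.
Variables (V W : framed R) (a : W -> W).
Hypothesis sa : bselfadj a.

Lemma lmul_is_hs (X : hs_space V W) : is_hs (a \o hs_fun X).
Proof.
have al := bselfadj_linear sa; have [_ [k k0 ak]] := sa.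
split; [by move=> c x y /=; rewrite hs_linear al|exact: bdd_comp sa.2 (hs_bdd X)|].
have [fk _] := rsumZ_le (sqr_ge0 k) (hs_finsum X).
apply: (proj1 (rsum_le fk (sq_image_ge0 _) _)) => i.
by rewrite /sq_image /= -!sqr_hnorm -exprMn ler_sqr ?nnegrE ?mulr_ge0 ?hnorm_ge0// ak.
Qed.

Definition lmul (X : hs_space V W) : hs_space V W := @Sub _ _ (hs_subspace V W) _ (lmul_is_hs X).

Lemma lmulE (X : hs_space V W) u : hs_fun (lmul X) u = a (hs_fun X u). Proof. by []. Qed.

Lemma lmul_bselfadj : bselfadj lmul.
Proof.
have al := bselfadj_linear sa; have [as_ [k k0 ak]] := sa.
split; last by exists k => // X; apply: hs_hnorm_le => // u; rewrite lmulE ak.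
move=> X Y; have := @hs_sq_eq _ V W [:: lmul X + Y; X; lmul Y] [:: X + lmul Y; lmul X; Y].
rewrite !big_cons !big_nil !addr0 => h.
have {h} : hs_sq (lmul X + Y) + (hs_sq X + hs_sq (lmul Y)) = hs_sq (X + lmul Y) + (hs_sq (lmul X) + hs_sq Y).
  apply: h => u; rewrite !big_cons !big_nil !addr0 !hs_addE !lmulE !ipE.
  move: (hs_fun X u) (hs_fun Y u) => x y.
  by rewrite (ipC y (a x)) (ipC (a y) x) (as_ x y); ring.
move=> h; rewrite -[LHS]/(hs_ip (lmul X) Y) -[RHS]/(hs_ip X (lmul Y)) /hs_ip; lra.
Qed.

(** If [a - l] were bounded below on vectors, it would be bounded below on
    Hilbert-Schmidt operators, term by term in the norm. *)
Lemma lmul_approx_eigenvalue l : approx_eigenvalue lmul l -> approx_eigenvalue a l.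
Proof.
move=> H e e0; apply: contrapT => neg.
have low (w : W) : e * hnorm w <= hnorm (a w - l *: w).
  have [->|wn] := pselect (w = 0); first by rewrite hnorm0 mulr0 hnorm_ge0.
  by rewrite leNgt; apply/negP => lt; apply: neg; exists w => //; exact: ltW.
have e20 : 0 < e / 2 by lra.
have [X Xn hX] := H _ e20.
have ei0 : 0 <= e^-1 by rewrite invr_ge0 ltW.
have : hnorm X <= e^-1 * hnorm (lmul X - l *: X).
  by apply: hs_hnorm_le => // u; rewrite ler_pdivlMl//; exact: low.
rewrite ler_pdivlMl// => h; apply: Xn; apply: hnorm_eq0; have := hnorm_ge0 X; nra.
Qed.

End LeftMultiplication.

Section RightMultiplication.
Variables (V W : framed R) (m : V -> V).
Hypothesis sm : bselfadj m.

(** Right multiplication by [m] is left multiplication seen through the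
    isometry that exchanges an operator with its adjoint; this is where its
    selfadjointness and its spectrum come from. *)
Definition rmul (X : hs_space V W) : hs_space V W := hs_adj (lmul sm (hs_adj X)).

Lemma rmulE (X : hs_space V W) u : hs_fun (rmul X) u = hs_fun X (m u).
Proof.
apply: ip_inj => w; by rewrite ipC -(hs_adjP (lmul sm (hs_adj X))) lmulE sm.1 ipC -(hs_adjP X) .
Qed.

Lemma rmul_bselfadj : bselfadj rmul.
Proof.
have [ls [k k0 lk]] := lmul_bselfadj W sm; split=> [X Y|].
  rewrite /rmul -[Y in LHS]hs_adjK hs_adj_ip ls -hs_adj_ip hs_adjK.
  by rewrite -hs_adj_ip !hs_adjK.
exists k => // X; have := lk (hs_adj X).
by rewrite /hnorm /rmul !hs_adj_isometry.
Qed.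

Lemma rmul_approx_eigenvalue r : approx_eigenvalue rmul r -> approx_eigenvalue m r.
Proof.
move=> H; apply: (@lmul_approx_eigenvalue W V m sm) => e /H[X Xn hX].
exists (hs_adj X) => [X0|]; first by apply: Xn; rewrite -[X]hs_adjK X0 lin0//; exact: hs_adj_linear.
have -> : lmul sm (hs_adj X) - r *: hs_adj X = hs_adj (rmul X - r *: X).
  by rewrite (linB (@hs_adj_linear _ _)) (linZ (@hs_adj_linear _ _)) /rmul hs_adjK.
by rewrite /hnorm !hs_adj_isometry.
Qed.

End RightMultiplication.

Section Sylvester.
Variables (V W : framed R) (n : V -> V) (b : W -> W) (g : R).
Hypotheses (sn : bselfadj n) (sb : bselfadj b).
Hypotheses (n_inj : forall u, n u = 0 -> u = 0) (b_inj : forall w, b w = 0 -> w = 0).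
Hypothesis g0 : 0 < g.
Hypothesis g_gap : forall l r, approx_eigenvalue (b \o b) l ->
  approx_eigenvalue (n \o n) r -> g ^+ 2 * (l * r) <= (r - l) ^+ 2.

Let sa : bselfadj (b \o b) := bselfadj_comp sb sb (fun=> erefl).
Let sm : bselfadj (n \o n) := bselfadj_comp sn sn (fun=> erefl).
Let B := @lmul V W b sb.
Let N := @rmul V W n sn.

Let BN : commutes B N.
Proof. by move=> X; apply: hs_inj => u; rewrite rmulE !lmulE rmulE. Qed.

(** The inequality of [commuting_form_ge] for left multiplication by [b b] and
    right multiplication by [n n]. *)
Lemma sylvester_bound (X : hs_space V W) : g * hnorm (B (N X)) <= hnorm (N (N X) - B (B X)).
Proof.
have sB : bselfadj B := lmul_bselfadj V sb; have sN : bselfadj N := rmul_bselfadj W sn.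
have LM : commutes (@lmul V W _ sa) (@rmul V W _ sm).
  by move=> Y; apply: hs_inj => u; rewrite rmulE !lmulE rmulE.
have LE Y : @lmul V W _ sa Y = B (B Y) by apply: hs_inj.
have ME Y : @rmul V W _ sm Y = N (N Y) by apply: hs_inj => u; rewrite !rmulE.
have := commuting_form_ge (lmul_bselfadj V sa) (rmul_bselfadj W sm) LM (g := g) _ X.
rewrite LE ME => h; rewrite -ler_sqr ?nnegrE ?mulr_ge0 ?hnorm_ge0 ?(ltW g0)// exprMn !sqr_hnorm.
have -> : ip (B (N X)) (B (N X)) = ip (N (N X)) (B (B X)) by rewrite sB.1 [RHS]sN.1 !BN.
apply: h => l r /lmul_approx_eigenvalue al /rmul_approx_eigenvalue ar; exact: g_gap.
Qed.

Lemma sylvester_inj (X : hs_space V W) :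
  (forall u, hs_fun X (n (n u)) = b (b (hs_fun X u))) -> X = 0.
Proof.
move=> h; have D0 : N (N X) - B (B X) = 0.
  by apply/eqP; rewrite subr_eq0; apply/eqP/hs_inj => u; rewrite !rmulE !lmulE.
have C0 : B (N X) = 0.
  apply: hnorm_eq0; apply/eqP; rewrite eq_le hnorm_ge0 andbT.
  by have := sylvester_bound X; rewrite D0 hnorm0 pmulr_rle0.
have N0 : N X = 0.
  apply: hs_inj => u; apply: b_inj.
  by have := congr1 (fun Y => hs_fun Y u) C0; rewrite /B lmulE.
rewrite -[X]hs_adjK; apply: etrans (lin0 (@hs_adj_linear _ _)); congr hs_adj.
apply: hs_inj => w; apply: n_inj; apply: ip_inj => u; rewrite ip0l.
rewrite sn.1 ipC -(hs_adjP X) -(rmulE sn) -/N N0; exact: ip0l.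
Qed.

(** By [sylvester_bound] the functional [X |-> <b X n, F>] is bounded by
    [|F| / g] times the norm of [X n n - b b X]; the vector that represents it
    solves the equation weakly, hence strongly since all the multiplications
    are selfadjoint. *)
Lemma sylvester_ex (F : hs_space V W) : exists2 T : hs_space V W, hnorm T <= hnorm F / g &
  forall u, hs_fun T (n (n u)) - b (b (hs_fun T u)) = b (hs_fun F (n u)).
Proof.
have sB : bselfadj B := lmul_bselfadj V sb; have sN : bselfadj N := rmul_bselfadj W sn.
have Bl := bselfadj_linear sB; have Nl := bselfadj_linear sN.
pose D X := N (N X) - B (B X).
have sD : bselfadj D := bselfadjB (bselfadj_comp sN sN (fun=> erefl)) (bselfadj_comp sB sB (fun=> erefl)).
have sC : bselfadj (B \o N) := bselfadj_comp sB sN BN.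
have [||||T [T1 T2 _]] := @riesz _ (hs_space V W) (hs_space V W) D (fun X => ip (B (N X)) F) (hnorm F / g).
- exact: bselfadj_linear sD.
- by move=> c X Y; rewrite Nl Bl !ipE.
- by rewrite divr_ge0 ?hnorm_ge0 ?ltW.
- move=> X; rewrite (le_trans (cauchy_schwarz _ _))// mulrC -mulrA ler_wpM2l ?hnorm_ge0//.
  by rewrite ler_pdivlMl// sylvester_bound.
exists T => // u.
have DT : D T = B (N F) by apply: ip_inj => X; rewrite ipC -sD.1 T2 sC.1 ipC.
have := congr1 (fun Y => hs_fun Y u) DT.
by rewrite /D hs_addE hs_oppE !rmulE !lmulE rmulE.
Qed.

End Sylvester.
End HilbertSchmidtOperators.

(** * Real inner product of a complex Hilbert space *)

Section Realification.
Context {R : realType} (W : lmodType R[i]).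

(** [W] with the scalars restricted to the reals. *)
Definition realified : Type := W.
HB.instance Definition _ := GRing.Zmodule.on realified.

Definition real_scale (c : R) (x : realified) : realified := (c%:C%C : R[i]) *: (x : W).

Lemma real_scaleA a b x : real_scale a (real_scale b x) = real_scale (a * b) x.
Proof. by rewrite /real_scale scalerA -rmorphM. Qed.
Lemma real_scale1 : left_id 1 real_scale.
Proof. by move=> x; exact: scale1r. Qed.
Lemma real_scaleDr : right_distributive real_scale +%R.
Proof. by move=> c x y; exact: scalerDr. Qed.
Lemma real_scaleDl x : {morph real_scale^~ x : a b / a + b}.
Proof. by move=> a b; rewrite /real_scale rmorphD scalerDl. Qed.

HB.instance Definition _ := GRing.Zmodule_isLmodule.Build R realified
  real_scaleA real_scale1 real_scaleDr real_scaleDl.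
End Realification.

Section ComplexHilbert.
Context {R : realType} {H : completeNormedModType R[i]}.
Variable dot : {dot H for Num.conj}.
Hypothesis dot_norm : forall x : H, dot x x = `|x| ^+ 2.
Implicit Types (x y z : H).

(** The inner product of the realification; [dotE] recovers [dot] from it. *)
Definition real_dot x y : R := complex.Re (dot x y).

Lemma dotC x y : dot x y = conjc (dot y x).
Proof. by rewrite hermC expr0 mul1r. Qed.

Lemma dotZl (c : R[i]) x y : dot (c *: x) y = c * dot x y.
Proof. exact: linearZl_LR. Qed.

Lemma dotZr (c : R[i]) x y : dot x (c *: y) = conjc c * dot x y.
Proof. by rewrite dotC dotZl rmorphM /= -dotC. Qed.

Lemma dotDl x y z : dot (x + y) z = dot x z + dot y z.
Proof. exact: linearDl. Qed.

Lemma rdotC x y : real_dot x y = real_dot y x.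
Proof. by rewrite /real_dot dotC; case: (dot y x). Qed.

Lemma rdotPl (c : R) x y z : real_dot (c%:C%C *: x + y) z = c * real_dot x z + real_dot y z.
Proof.
rewrite /real_dot dotDl dotZl; case: (dot x z) => a b; case: (dot y z) => a' b'.
by rewrite /= mul0r subr0.
Qed.

Lemma dotE x y : dot x y = (real_dot x y +i* real_dot x ('i%C *: y))%C.
Proof.
by rewrite /real_dot dotZr; case: (dot x y) => a b /=; congr (_ +i* _)%C; ring.
Qed.

Lemma norm_real x : `|x| = (complex.Re `|x|)%:C%C.
Proof. by rewrite RRe_real// ger0_real. Qed.

Lemma rdot_norm x : real_dot x x = complex.Re `|x| ^+ 2.
Proof. by rewrite /real_dot dot_norm norm_real -rmorphXn. Qed.

Lemma Re_norm_ge0 x : 0 <= complex.Re `|x|.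
Proof. by rewrite -ler0c -norm_real. Qed.

Lemma sqrt_rdot x : Num.sqrt (real_dot x x) = complex.Re `|x|.
Proof. by rewrite rdot_norm sqrtr_sqr ger0_norm// Re_norm_ge0. Qed.

Lemma rdot_ge0 x : 0 <= real_dot x x.
Proof. by rewrite rdot_norm sqr_ge0. Qed.

Lemma rdot_eq0 x : real_dot x x = 0 -> x = 0.
Proof.
rewrite rdot_norm => /eqP; rewrite sqrf_eq0 => /eqP e.
by apply/normr0_eq0; rewrite norm_real e.
Qed.

Lemma complex_gt0 (e : R[i]) : 0 < e -> 0 < complex.Re e /\ e = (complex.Re e)%:C%C.
Proof.
move=> e0; have er : e = (complex.Re e)%:C%C by rewrite RRe_real// gtr0_real.
by split=> //; rewrite -ltcR -er.
Qed.

Lemma subspace_complete (S : set H) (u : nat -> H) : closed S -> (forall n, S (u n)) ->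
  (forall e : R, 0 < e -> exists N, forall m n, (N <= m)%N -> (N <= n)%N ->
     Num.sqrt (real_dot (u m - u n) (u m - u n)) <= e) ->
  exists2 l, S l & forall e : R, 0 < e -> exists N, forall n, (N <= n)%N ->
     Num.sqrt (real_dot (u n - l) (u n - l)) <= e.
Proof.
move=> cS uS cau.
have /cauchy_cvg uc : cauchy (u @ \oo).
  apply: cauchy_exP => e /complex_gt0[e0 ee].
  have e20 : 0 < complex.Re e / 2 by lra.
  have [N hN] := cau _ e20; exists (u N); exists N => // n /= Nn.
  rewrite -ball_normE /= norm_real ee ltcR -sqrt_rdot.
  by have := hN N n (leqnn _) Nn; lra.
exists (lim (u @ \oo)).
  apply: (@closed_cvg _ _ (u @ \oo) _ id S cS) => //.
  by exists 0%N => // n _; exact: uS.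
move=> e e0; have : 0 < e%:C%C by rewrite ltcR.
move: uc => /cvgrPdist_le /[apply] -[N _ hN]; exists N => n /hN.
by rewrite distrC norm_real lecR -sqrt_rdot.
Qed.
End ComplexHilbert.

(** * Closed subspaces and their orthonormal bases *)

Section ClosedSubspaces.
Context {R : realType} {H : completeNormedModType R[i]}.
Variable dot : {dot H for Num.conj}.
Hypothesis dot_norm : forall x : H, dot x x = `|x| ^+ 2.
Implicit Types (V : set H).
Local Notation rdot := (real_dot dot).

Lemma closed_subspace0 V : closed_subspace V -> V 0.
Proof. by move=> [_ [/set_mem]]. Qed.

Lemma closed_subspaceP V (c : R[i]) x y : closed_subspace V -> V x -> V y -> V (c *: x + y).
Proof.
by move=> [_ [_ h]] Vx Vy; apply: set_mem; apply: h; exact: mem_set.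
Qed.

Lemma closed_subspace_intro V : closed V -> V 0 ->
  (forall (c : R[i]) x y, V x -> V y -> V (c *: x + y)) -> closed_subspace V.
Proof.
move=> cV V0 VP; split=> //; split; first exact: mem_set.
by move=> c x y /set_mem Vx /set_mem Vy; apply: mem_set; exact: VP.
Qed.

Lemma closed_subspaceZ V (c : R[i]) x : closed_subspace V -> V x -> V (c *: x).
Proof.
move=> hV Vx; have := closed_subspaceP c hV Vx (closed_subspace0 hV).
by rewrite addr0.
Qed.

Lemma rdotZl (c : R) x y : rdot (c%:C%C *: x) y = c * rdot x y.
Proof. by rewrite /real_dot dotZl; case: (dot x y) => a b /=; rewrite mul0r subr0. Qed.

Lemma rdotDl x y z : rdot (x + y) z = rdot x z + rdot y z.
Proof. by rewrite -[x in LHS]scale1r -[1]/(1%:C%C) rdotPl mul1r. Qed.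

Lemma rdotNl x z : rdot (- x) z = - rdot x z.
Proof. by rewrite -scaleN1r -(rmorphN1 (real_complex R)) rdotZl mulN1r. Qed.

Lemma rdotNr x z : rdot z (- x) = - rdot z x.
Proof. by rewrite !(rdotC dot z) rdotNl. Qed.

Lemma rdotBl x y z : rdot (x - y) z = rdot x z - rdot y z.
Proof. by rewrite rdotDl rdotNl. Qed.

Lemma rdotBr x y z : rdot z (x - y) = rdot z x - rdot z y.
Proof. by rewrite !(rdotC dot z) rdotBl. Qed.

Lemma rdotDr x y z : rdot z (x + y) = rdot z x + rdot z y.
Proof. by rewrite !(rdotC dot z) rdotDl. Qed.

Lemma rdot_i x y : rdot ('i%C *: x) ('i%C *: y) = rdot x y.
Proof.
by rewrite /real_dot dotZl dotZr; case: (dot x y) => a b /=; ring.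
Qed.

Lemma closed_approx V x : closed V ->
  (forall e : R, 0 < e -> exists2 z, V z & Num.sqrt (rdot (z - x) (z - x)) <= e) -> V x.
Proof.
move=> cV h; apply: cV => B /nbhs_ballP[e /= /complex_gt0[e0 ee] Be].
have e20 : 0 < complex.Re e / 2 by lra.
have [z Vz zx] := h _ e20; exists z; split=> //; apply: Be.
rewrite -ball_normE /= distrC norm_real ee ltcR -(sqrt_rdot dot_norm).
by apply: le_lt_trans zx _; lra.
Qed.

Section Space.
Variables (V : set H) (hV : closed_subspace V).

Definition csubspace : subspace (realified H) :=
  @Subspace R (realified H) V (closed_subspace0 hV)
    (fun c x y => closed_subspaceP (c%:C%C) hV).

Definition cs_ip (x y : sub_type csubspace) : R := rdot (sub_val x) (sub_val y).

Lemma cs_ip_eq0 (x : sub_type csubspace) : cs_ip x x = 0 -> x = 0.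
Proof.
move=> h; apply: sub_inj; change (sub_val x = (0 : H)).
exact: (@rdot_eq0 R H dot dot_norm _ h).
Qed.

Lemma cs_complete (u : nat -> sub_type csubspace) :
    (forall e : R, 0 < e -> exists N, forall m n, (N <= m)%N -> (N <= n)%N ->
       Num.sqrt (cs_ip (u m - u n) (u m - u n)) <= e) ->
    exists l, forall e : R, 0 < e -> exists N, forall n, (N <= n)%N ->
       Num.sqrt (cs_ip (u n - l) (u n - l)) <= e.
Proof.
move=> cau; have [l Vl ul] := subspace_complete dot_norm hV.1 (fun n => sub_prop (u n)) cau.
by exists (@Sub _ _ csubspace l Vl).
Qed.

Definition closed_space : hilbert R := @Hilbert R (sub_type csubspace) cs_ip
  (fun _ _ => rdotC dot _ _) (fun c _ _ _ => rdotPl dot c _ _ _)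
  (fun _ => rdot_ge0 dot_norm _)
  cs_ip_eq0 cs_complete.

(** Total, with the value 0 outside [V], so that operators given as graphs
    become plain functions between spaces. *)
Definition to_closed_space x : closed_space :=
  if pselect (V x) is left Vx then @Sub _ _ csubspace x Vx else 0.

Definition out (x : closed_space) : H := sub_val x.

Lemma outK (x : closed_space) : to_closed_space (out x) = x.
Proof.
rewrite /to_closed_space; case: pselect => [Vx|nV]; first exact: sub_inj.
by case: nV; exact: (@sub_prop _ _ csubspace x).
Qed.

Lemma intoK x : V x -> out (to_closed_space x) = x.
Proof. by rewrite /to_closed_space; case: pselect. Qed.

Lemma outP (x : closed_space) : V (out x). Proof. exact: (@sub_prop _ _ csubspace x). Qed.

Lemma ip_out (x y : closed_space) : ip x y = rdot (out x) (out y).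
Proof. by []. Qed.

Lemma out_inj (x y : closed_space) : out x = out y -> x = y.
Proof. exact: (@sub_inj _ _ csubspace x y). Qed.

(** The complex structure, as a real-linear map of the realification. *)
Definition mul_i (x : closed_space) : closed_space := to_closed_space ('i%C *: out x).

Lemma out_mul_i (x : closed_space) : out (mul_i x) = 'i%C *: out x.
Proof. by rewrite intoK//; apply: closed_subspaceZ => //; exact: outP. Qed.

End Space.

(** Given a maximal orthonormal set, the projection of a vector of [V] onto a
    closed subspace containing this set is the vector itself, otherwise the
    normalised difference would extend the set. *)
Lemma orthonormal_basis_ex V : closed_subspace V -> exists E, orthonormal_basis dot V E.
Proof.
move=> hV.
pose P := [set E : set H | E `<=` V /\
  forall e f, E e -> E f -> dot e f = (e == f)%:R].
have [F FP tF|E [[EV Eo] Emax]] := @Zorn_bigcup _ P.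
  split=> [e [A FA Ae]|e f [A FA Ae] [B FB Bf]]; first exact: (FP _ FA).1.
  have [AB|BA] := tF _ _ FA FB; first exact: (FP _ FB).2 (AB _ Ae) Bf.
  exact: (FP _ FA).2 Ae (BA _ Bf).
exists E; split=> //; apply/seteqP; split; first exact: smallest_sub.
move=> x Vx M [hM EM].
have hW : closed_subspace (M `&` V).
  apply: closed_subspace_intro; first exact: closedI hM.1 hV.1.
    by split; exact: closed_subspace0.
  by move=> c y z [My Vy] [Mz Vz]; split; exact: closed_subspaceP.
pose D (z : closed_space hW) : closed_space hV := @to_closed_space V hV (out z).
have DE z : out (D z) = out z by rewrite intoK//; case: (outP z).
have [||||T [_ T2 T3]] := @riesz _ (closed_space hW) (closed_space hV) D
  (fun z => rdot (out z) x) (hnorm (to_closed_space hV x)).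
- by move=> c y z; apply: out_inj; rewrite DE [RHS]/(c%:C%C *: out (D y) + out (D z)) !DE.
- by move=> c y z; exact: rdotPl.
- exact: hnorm_ge0.
- move=> z; rewrite mulrC; have := cauchy_schwarz (D z) (to_closed_space hV x).
  by rewrite ip_out DE intoK.
have MT : M (out T).
  apply: closed_approx hM.1 _ => e /T3[z hz]; exists (out z); first by case: (outP z).
  by move: hz; rewrite /hnorm ip_out [out (_ - _)]/(out (D z) - out T) DE.
suff -> : x = out T by [].
apply/eqP; rewrite -subr_eq0; apply: contrapT => /negP dn.
set d := x - out T in dn.
have Vd : V d by rewrite /d addrC -scaleN1r; apply: closed_subspaceP => //; exact: outP.
have rorth z : M z -> V z -> rdot z d = 0.
  move=> Mz Vz; have Wz : (M `&` V) z by [].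
  have := T2 (to_closed_space hW z); rewrite ip_out DE intoK// => e.
  by rewrite /d rdotBr e subrr.
have orth z : M z -> V z -> dot d z = 0.
  move=> Mz Vz; rewrite dotC dotE rorth//.
  have : rdot z ('i%C *: d) = - rdot ('i%C *: z) d.
    by rewrite /real_dot dotZl dotZr; case: (dot z d) => a b /=; ring.
  move=> ->; rewrite rorth ?oppr0; [exact: conjc0| |]; exact: closed_subspaceZ.
have d0 : 0 < rdot d d.
  rewrite lt_def rdot_ge0// andbT; apply: contra dn => /eqP h.
  by apply/eqP; exact: rdot_eq0 h.
pose c : R := (Num.sqrt (rdot d d))^-1; pose e := c%:C%C *: d.
have ee : dot e e = 1.
  rewrite dotZl dotZr dot_norm norm_real -(sqrt_rdot dot_norm) conjc_real.
  rewrite -!rmorphXn -!rmorphM expr2 /= /c -(rmorph1 (real_complex R)).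
  by congr (_ %:C)%C; field; rewrite sqrtr_eq0 -ltNge.
have eE f : E f -> dot e f = 0.
  by move=> Ef; rewrite dotZl orth ?mulr0//; [exact: EM|exact: EV].
have En : ~ E e by move=> /eE; rewrite ee => /eqP; rewrite oner_eq0.
have Ef f : E f -> (e == f) = false by move=> Ef; apply/eqP => ef; apply: En; rewrite ef.
apply: (Emax (E `|` [set e])).
  split=> [|/(_ e)]; first by move=> ?; left.
  by move=> h; apply: En; apply: h; right.
split=> [f [/EV//|->]|f g [Ff|->] [Fg|->]].
- exact: closed_subspaceZ.
- exact: Eo.
- by rewrite dotC eE// eq_sym Ef// conjc0.
- by rewrite eE// Ef.
- by rewrite eqxx.
Qed.

(** The squared modulus of [dot x e]. *)
Definition coef x e := rdot x e ^+ 2 + rdot x ('i%C *: e) ^+ 2.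

Lemma coef_ge0 x e : 0 <= coef x e.
Proof. by rewrite addr_ge0 ?sqr_ge0. Qed.

Section Parseval.
Variables (V E : set H).
Hypotheses (hV : closed_subspace V) (hE : orthonormal_basis dot V E).

Lemma basis_sub : E `<=` V.
Proof. by move=> e Ee; rewrite -hE.2; exact: sub_gen_smallest. Qed.

Lemma bessel x A : fsets E A -> \sum_(e <- fset_set A) coef x e <= rdot x x.
Proof.
move=> [fA AE]; set s := fset_set A.
have sE e : e \in s -> E e by rewrite in_fset_set// inE => /AE.
have dot0l y : dot 0 y = 0 by rewrite -(scale0r 0) dotZl mul0r.
pose p := \sum_(e <- s) dot x e *: e.
have dp y : dot p y = \sum_(e <- s) dot x e * dot e y.
  rewrite /p (big_morph (dot^~ y) (fun a b => dotDl dot a b y) (dot0l y)).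
  by apply: eq_bigr => e _; rewrite dotZl.
have pe e : e \in s -> dot p e = dot x e.
  move=> es; rewrite dp (bigD1_seq e)//= big_seq_cond big1 ?addr0.
    by rewrite (hE.1 e e) ?eqxx ?mulr1//; exact: sE.
  move=> f /andP[fs fe].
  by rewrite (hE.1 f e) ?(negbTE fe) ?mulr0//; exact: sE.
have rp y : (forall e, e \in s -> dot y e = dot x e) ->
    rdot p y = \sum_(e <- s) coef x e.
  move=> ye; rewrite /real_dot dp (raddf_sum (@complex.Re R)) big_seq [RHS]big_seq.
  apply: eq_bigr => e es; rewrite [dot e y]dotC ye// /coef dotE.
  by rewrite /=; ring.
have := rdot_ge0 dot_norm (x - p).
rewrite rdotBl !rdotBr (rdotC dot x p) (rp x)// (rp p)//; lra.
Qed.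

Lemma coef_finsum x : finsum E (coef x) /\ rsum E (coef x) <= rdot x x.
Proof. by apply: rsum_lub => [|A]; [exact: coef_ge0|exact: bessel]. Qed.

(** A nonnegative quadratic form, the squared distance from [x] to the closed
    span of [E]; its zeros form a closed subspace that contains [E], hence
    [V], which is the Parseval identity. *)
Definition defect x := rdot x x - rsum E (coef x).

Lemma defect_ge0 x : 0 <= defect x.
Proof. by rewrite subr_ge0; case: (coef_finsum x). Qed.

Lemma defect_parallelogram x y :
  defect (x + y) + defect (x - y) = 2 * defect x + 2 * defect y.
Proof.
have f z := (coef_finsum z).1.
have [_ e1] := rsumD (f (x + y)) (f (x - y)).
have [f2 _] := rsumZ_le (ler0n R 2) (f x); have [f3 _] := rsumZ_le (ler0n R 2) (f y).
have [_ e2] := rsumD f2 f3.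
rewrite (rsumZ (ler0n R 2) (f x)) (rsumZ (ler0n R 2) (f y)) in e2.
have : rsum E (fun i => coef (x + y) i + coef (x - y) i) =
       rsum E (fun i => 2 * coef x i + 2 * coef y i).
  by apply: eq_rsum => i _; rewrite /coef !(rdotDl, rdotNl); ring.
rewrite /defect !(rdotDl, rdotNl, rdotDr, rdotNr) (rdotC dot y x); lra.
Qed.

Lemma defectZ (c : R[i]) x : defect (c *: x) = complex.Re (c * conjc c) * defect x.
Proof.
have c0 : 0 <= complex.Re (c * conjc c) by case: c => a b /=; rewrite mulrN opprK addr_ge0// -expr2 sqr_ge0.
rewrite /defect mulrBr -(rsumZ c0 (coef_finsum x).1); congr (_ - _).
  rewrite /real_dot dotZl dotZr dot_norm norm_real -rmorphXn.
  by case: c {c0} => a b /=; ring.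
apply: eq_rsum => i _; rewrite /coef /real_dot !dotZl !dotZr.
by case: c {c0} => a b; case: (dot x i) => u v /=; ring.
Qed.

Lemma parseval_rdot x : V x -> rsum E (coef x) = rdot x x.
Proof.
have hW : closed_subspace [set z | defect z = 0].
  have D0 z : (defect z <= 0) -> defect z = 0.
    by move=> h; apply/eqP; rewrite eq_le h defect_ge0.
  have DD y z : defect y = 0 -> defect z = 0 -> defect (y + z) = 0.
    move=> hy hz; apply: D0; have := defect_parallelogram y z.
    by rewrite hy hz; have := defect_ge0 (y - z); lra.
  apply: closed_subspace_intro.
  - move=> y yc; apply: D0; apply/ler_addgt0Pr => e e0; rewrite add0r.
    pose d := Num.sqrt (e / 2).
    have d0 : 0 < d by rewrite sqrtr_gt0; lra.
    have dC : 0 < d%:C%C :> R[i] by rewrite ltcR.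
    have [z [/= hz]] := yc _ (nbhsx_ballx y _ dC).
    rewrite -ball_normE /= norm_real ltcR -(sqrt_rdot dot_norm) => zd.
    have h1 : rdot (y - z) (y - z) <= e / 2.
      rewrite -ler_sqrt; [exact: ltW|lra].
    have h2 : defect (y - z) <= rdot (y - z) (y - z).
      by rewrite /defect; have := rsum_ge0 (coef_finsum (y - z)).1; lra.
    have := defect_parallelogram z (y - z); rewrite (addrC z) subrK hz.
    by have := defect_ge0 (z - (y - z)); lra.
  - by rewrite /= -(scale0r 0) defectZ mul0r /= mul0r.
  - by move=> c y z /= hy hz; apply: DD => //; rewrite defectZ hy mulr0.
move=> Vx; have : smallest closed_subspace E `<=` [set z | defect z = 0].
  apply: smallest_sub => // e Ee /=; apply/eqP; rewrite eq_le defect_ge0 andbT.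
  have [fe _] := coef_finsum e.
  have A1 : fsets E [set e] by split=> // _ ->.
  have := rsum_fin_le fe A1; rewrite fset_set1 big_seq_fset1 /defect.
  by rewrite /coef /real_dot dotZr (hE.1 e e Ee Ee) eqxx /= => h; nra.
rewrite hE.2 => /(_ x Vx) /eqP; rewrite subr_eq0 => /eqP //.
Qed.

End Parseval.
End ClosedSubspaces.

(** * Everywhere defined operators as graphs *)

Section Frames.
Context {R : realType} {H : completeNormedModType R[i]}.
Variable dot : {dot H for Num.conj}.
Hypothesis dot_norm : forall x : H, dot x x = `|x| ^+ 2.
Local Notation rdot := (real_dot dot).
Local Notation cspace := (closed_space dot_norm).
Local Notation into := (to_closed_space dot_norm).

Lemma rdot_ir x y : rdot x ('i%C *: y) = - rdot ('i%C *: x) y.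
Proof. by rewrite /real_dot dotZl dotZr; case: (dot x y) => a b /=; ring. Qed.

Lemma rdot_orth0 V (hV : closed_subspace V) x : V x ->
  (forall z, V z -> rdot z x = 0) -> x = 0.
Proof. by move=> Vx h; apply: (rdot_eq0 dot_norm); exact: h. Qed.

Lemma outD V (hV : closed_subspace V) (x y : cspace hV) : out (x + y) = out x + out y.
Proof. by []. Qed.
Lemma outN V (hV : closed_subspace V) (x : cspace hV) : out (- x) = - out x.
Proof. by []. Qed.
Lemma outZ V (hV : closed_subspace V) (c : R) (x : cspace hV) : out (c *: x) = c%:C%C *: out x.
Proof. by []. Qed.
Lemma out0 V (hV : closed_subspace V) : out (0 : cspace hV) = 0.
Proof. by []. Qed.

Lemma mul_i_linear V (hV : closed_subspace V) : linear (@mul_i _ _ _ dot_norm V hV).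
Proof.
move=> c x y; apply: out_inj.
rewrite outD outZ !out_mul_i outD outZ scalerDr !scalerA.
by congr (_ *: _ + _); rewrite mulrC.
Qed.

Lemma mul_i_sqr V (hV : closed_subspace V) (x : cspace hV) : mul_i (mul_i x) = - x.
Proof. by apply: out_inj; rewrite !out_mul_i scalerA -expr2 sqr_i scaleN1r. Qed.

Lemma mul_i_isometry V (hV : closed_subspace V) (x : cspace hV) : ip (mul_i x) (mul_i x) = ip x x.
Proof. by rewrite !ip_out !out_mul_i rdot_i. Qed.

Lemma mul_i_bdd V (hV : closed_subspace V) : bdd (@mul_i _ _ _ dot_norm V hV).
Proof. by exists 1 => // x; rewrite mul1r /hnorm mul_i_isometry. Qed.

(** How complex-linearity is recovered from the real theory: a complex scalar
    acts through two real ones and [mul_i]. *)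
Lemma complex_linear V W (hV : closed_subspace V) (hW : closed_subspace W)
    (f : cspace hV -> cspace hW) : linear f -> (forall x, f (mul_i x) = mul_i (f x)) ->
  forall (c : R[i]) (x : cspace hV), out (f (into hV (c *: out x))) = c *: out (f x).
Proof.
move=> fl fi [a b] x.
have cE y : (a +i* b)%C *: y = a%:C%C *: y + b%:C%C *: ('i%C *: y) :> H.
  rewrite scalerA -scalerDl; congr (_ *: _); apply/eqP; rewrite eq_complex /=.
  by rewrite !mul0r !mulr0 !mulr1 subrr !addr0 add0r !eqxx.
have -> : into hV ((a +i* b)%C *: out x) = a *: x + b *: mul_i x.
  apply: out_inj; rewrite intoK ?outD ?outZ ?out_mul_i ?cE//.
  by rewrite -cE; apply: closed_subspaceZ => //; exact: outP.
by rewrite fl (linZ fl) outD !outZ fi out_mul_i cE.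
Qed.

(** The imaginary part of the identity is, up to sign, its real part at [mul_i x]. *)
Lemma dot_adjoint V W (hV : closed_subspace V) (hW : closed_subspace W)
    (f : cspace hV -> cspace hW) (w y : H) : (forall x, f (mul_i x) = mul_i (f x)) ->
  (forall x, rdot (out (f x)) w = rdot (out x) y) ->
  forall x, dot (out (f x)) w = dot (out x) y.
Proof.
by move=> fi h x; rewrite !(dotE dot) !rdot_ir -!out_mul_i -fi !h.
Qed.

Lemma esum_bool (a : bool -> R) : (forall b, 0 <= a b) ->
  \esum_(b in [set: bool]) (a b)%:E = (a false + a true)%:E.
Proof.
move=> a0; rewrite (esumID [set true]) => [|b _]; last by rewrite lee_fin.
have -> : [set: bool] `&` [set true] = [set true] by rewrite setTI.
have -> : [set: bool] `&` ~` [set true] = [set false].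
  by rewrite setTI; apply/seteqP; split=> -[] //= /(_ erefl).
by rewrite !esum_set1 ?lee_fin// -EFinD addrC.
Qed.

Section BasisFrame.
Variables (V E : set H) (hV : closed_subspace V) (hE : orthonormal_basis dot V E).

(** The real orthonormal basis made of the [e] and [i e]. *)
Definition basis_vec (p : H * bool) : cspace hV :=
  into hV (if p.2 then 'i%C *: p.1 else p.1).

Definition basis_dom : set (H * bool) := E `*`` (fun=> [set: bool]).

Lemma esum_basis (a : H * bool -> R) : (forall p, 0 <= a p) ->
  \esum_(p in basis_dom) (a p)%:E = \esum_(e in E) (a (e, false) + a (e, true))%:E.
Proof.
move=> a0; have a0' e b : E e -> [set: bool] b -> (0 <= (a (e, b))%:E)%E by rewrite lee_fin.
transitivity (\esum_(e in E) \esum_(b in [set: bool]) (a (e, b))%:E).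
  by rewrite (esum_esum a0'); apply: eq_esum => -[].
by apply: eq_esum => e _; exact: esum_bool.
Qed.

Lemma out_basis_vec e b : E e -> out (basis_vec (e, b)) = if b then 'i%C *: e else e.
Proof.
move=> Ee; have Ve := basis_sub hE Ee.
by rewrite intoK//=; case: b => //; exact: closed_subspaceZ.
Qed.

Lemma basis_parseval (x : cspace hV) :
  \esum_(p in basis_dom) (ip x (basis_vec p) ^+ 2)%:E = (ip x x)%:E.
Proof.
rewrite esum_basis => [|p]; last exact: sqr_ge0.
rewrite ip_out -(parseval_rdot dot_norm hE (outP x)) -esum_rsum; last first.
  exact: (coef_finsum dot_norm hE (out x)).1.
by apply: eq_esum => e Ee; rewrite !ip_out !out_basis_vec.
Qed.

Definition cframe : framed R := Framed basis_parseval.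

End BasisFrame.

Section GraphOperators.
Variables (V W : set H) (hV : closed_subspace V) (hW : closed_subspace W).

Lemma app_graph (K : set (H * H)) x : domain K x -> K (x, app K x).
Proof. by move=> [[x' y] Ky /= <-]; apply: (@xgetPex _ 0 [set y | K (x', y)]); exists y. Qed.

Lemma app_eq (K : set (H * H)) x y : (forall z, K (x, z) -> z = y) -> K (x, y) -> app K x = y.
Proof. by move=> uy Kxy; apply: uy; apply: app_graph; exists (x, y). Qed.

Lemma linear_operatorP (K : set (H * H)) (c : R[i]) x y x' y' : linear_operator V W K ->
  K (x, y) -> K (x', y') -> K (c *: x + x', c *: y + y').
Proof.
by move=> [_ [_ h] _] K1 K2; apply: set_mem; apply: (h c (x, y) (x', y')); exact: mem_set.
Qed.

Definition op_fun (K : set (H * H)) (x : cspace hV) : cspace hW := into hW (app K (out x)).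

Definition graph_of (f : cspace hV -> cspace hW) : set (H * H) :=
  [set p | exists x, p = (out x, out (f x))].

Section OpFun.
Variable K : set (H * H).
Hypothesis bK : bounded_operator V W K.

Lemma op_graph (x : cspace hV) : K (out x, app K (out x)).
Proof. by case: bK => _ e _; apply: app_graph; rewrite e; exact: outP. Qed.

Lemma op_funE x : out (op_fun K x) = app K (out x).
Proof. by rewrite intoK//; case: bK => -[KVW _ _] _ _; case: (KVW _ (op_graph x)). Qed.

Lemma op_app x y : K (x, y) -> app K x = y.
Proof. by move=> Kxy; apply: app_eq => // z Kxz; case: bK => -[_ _ Ku] _ _; exact: Ku Kxz Kxy. Qed.

Lemma op_fun_clinear (c : R[i]) (x y : cspace hV) :
  app K (c *: out x + out y) = c *: app K (out x) + app K (out y).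
Proof. by apply: op_app; case: bK => Kl _ _; apply: linear_operatorP Kl _ _; exact: op_graph. Qed.

Lemma op_fun_linear : linear (op_fun K).
Proof.
move=> c x y; apply: out_inj; rewrite outD outZ !op_funE -op_fun_clinear.
by rewrite outD outZ.
Qed.

Lemma op_fun_i x : op_fun K (mul_i x) = mul_i (op_fun K x).
Proof.
apply: out_inj; rewrite out_mul_i !op_funE out_mul_i.
have := op_fun_clinear 'i%C x 0; rewrite !out0 !addr0 => ->.
rewrite (_ : app K 0 = 0) ?addr0//.
by apply: op_app; case: bK => -[_ [+ _] _] _ _ => /set_mem.
Qed.

Lemma op_fun_bdd : bdd (op_fun K).
Proof.
case: bK => _ _ [c hc]; exists `|c| => // x.
have := hc _ (outP x); rewrite -op_funE norm_real (norm_real (out x)) -rmorphM lecR.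
rewrite /hnorm !ip_out !(sqrt_rdot dot_norm) => /le_trans; apply.
by rewrite ler_wpM2r ?Re_norm_ge0// ler_norm.
Qed.

Lemma graph_op_fun : graph_of (op_fun K) = K.
Proof.
apply/seteqP; split=> [_ [x ->]|[x y] Kxy]; first by rewrite op_funE; exact: op_graph.
have [[KVW _ _] _ _] := bK; have [/= Vx _] := KVW _ Kxy.
by exists (into hV x); rewrite op_funE !intoK// (op_app Kxy).
Qed.

End OpFun.

Lemma graph_of_bounded f : linear f -> bdd f -> (forall x, f (mul_i x) = mul_i (f x)) ->
  bounded_operator V W (graph_of f).
Proof.
move=> fl [k k0 fk] fi; have fcl := complex_linear fl fi.
have fu x y : graph_of f (x, y) -> y = out (f (into hV x)).
  by move=> [z [-> ->]]; rewrite outK.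
split; first split.
- by move=> _ [x ->]; split; exact: outP.
- split; first by apply: mem_set; exists 0; rewrite (lin0 fl) !out0.
  move=> c _ _ /set_mem[x ->] /set_mem[y ->]; apply: mem_set.
  exists (into hV (c *: out x) + y); rewrite (linD fl) !outD fcl intoK//.
  by apply: closed_subspaceZ => //; exact: outP.
- by move=> x y z /fu -> /fu ->.
- apply/seteqP; split=> [_ [_ [x ->] <-]|x Vx]; first exact: outP.
  by exists (x, out (f (into hV x))) => //; exists (into hV x); rewrite intoK.
- exists k => x Vx; have gx : graph_of f (x, out (f (into hV x))).
    by exists (into hV x); rewrite intoK.
  rewrite (app_eq (fun z => @fu x z) gx) norm_real (norm_real x) -rmorphM lecR.
  have := fk (into hV x); rewrite /hnorm !ip_out intoK// !(sqrt_rdot dot_norm).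
  exact.
Qed.

Lemma op_fun_graph f : linear f -> bdd f -> (forall x, f (mul_i x) = mul_i (f x)) ->
  forall x, op_fun (graph_of f) x = f x.
Proof.
move=> fl fb fi x; apply: out_inj; have bG := graph_of_bounded fl fb fi.
rewrite (op_funE bG); apply: (op_app bG); by exists x.
Qed.

Local Notation basis V := (xget set0 [set E | orthonormal_basis dot V E]).

Lemma basisP U : closed_subspace U -> orthonormal_basis dot U (basis U).
Proof.
move=> hU; apply: (@xgetPex _ set0 [set E | orthonormal_basis dot U E]).
exact: orthonormal_basis_ex.
Qed.

(** [K^* K e] exists by the Riesz theorem, and pairing it with [e] gives the
    squared norm of [K e]; this turns the trace into a Hilbert-Schmidt sum. *)
Lemma trace_adjoint K : bounded_operator V W K ->
  trace dot V (adjoint dot V W K \; K)%relation =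
  \esum_(e in basis V) (ip (op_fun K (into hV e)) (op_fun K (into hV e)))%:E.
Proof.
move=> bK; rewrite /trace; apply: eq_esum => e Ee; congr EFin.
have Ve := basis_sub (basisP hV) Ee.
have [Y XY] := adjoint_ex (op_fun_linear bK) (op_fun_bdd bK).
set w := op_fun K (into hV e).
have we : out w = app K e by rewrite op_funE// intoK.
have adj : adjoint dot V W K (out w, out (Y w)).
  split; [exact: outP|exact: outP|] => x y Kxy /=.
  have [[KVW _ _] _ _] := bK; have [/= Vx Wy] := KVW _ Kxy.
  have -> : y = out (op_fun K (into hV x)) by rewrite op_funE// intoK// (op_app bK Kxy).
  rewrite -[in RHS](intoK dot_norm hV Vx).
  apply: (dot_adjoint (w := out w) (y := out (Y w)) (op_fun_i bK)) => z.
  by rewrite -!ip_out XY.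
rewrite (app_eq (y := out (Y w))) => [||].
- have -> : complex.Re (dot (out (Y w)) e) = ip (Y w) (into hV e).
    by rewrite ip_out intoK.
  by rewrite ipC -XY.
- move=> z [w' /= Kw' [_ Vz hz]]; rewrite -(op_app bK Kw') -we in hz.
  have [_ _ hY] := adj.
  apply/eqP; rewrite -subr_eq0; apply/eqP; apply: (rdot_orth0 hV).
    by rewrite addrC -scaleN1r; apply: closed_subspaceP => //; exact: outP.
  move=> x Vx; have Kx := op_graph bK (into hV x); rewrite intoK// in Kx.
  by rewrite rdotBr /real_dot -(hz _ _ Kx) -(hY _ _ Kx) subrr.
- exists (out w) => //=; rewrite we; have := op_graph bK (into hV e).
  by rewrite intoK.
Qed.

End GraphOperators.
End Frames.

(** * Positive definite operators, their inverses and roots *)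

Section UnboundedOperators.
Context {R : realType} {H : completeNormedModType R[i]}.
Variable dot : {dot H for Num.conj}.
Hypothesis dot_norm : forall x : H, dot x x = `|x| ^+ 2.
Local Notation rdot := (real_dot dot).
Local Notation cspace := (closed_space dot_norm).
Local Notation into := (to_closed_space dot_norm).

Section HilbertSchmidtNorm.
Variables (V W : set H) (hV : closed_subspace V) (hW : closed_subspace W).

Definition basis_frame U (hU : closed_subspace U) : framed R :=
  cframe dot_norm hU (basisP dot_norm hU).

(** The vectors [e] and [i e] contribute equally, so the real
    Hilbert-Schmidt norm is the complex one up to the factor [sqrt 2]. *)
Lemma esum_sq_image (f : cspace hV -> cspace hW) : (forall x, f (mul_i x) = mul_i (f x)) ->
  \esum_(p in frame_dom (basis_frame hV)) (@sq_image R (basis_frame hV) (cspace hW) f p)%:E =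
  (\esum_(e in xget set0 [set E | orthonormal_basis dot V E])
     (ip (f (into hV e)) (f (into hV e)))%:E +
   \esum_(e in xget set0 [set E | orthonormal_basis dot V E])
     (ip (f (into hV e)) (f (into hV e)))%:E)%E.
Proof.
move=> fi; rewrite esum_basis => [|p]; last exact: ip_ge0.
rewrite -esumD => [|e _|e _]; [|by rewrite lee_fin ip_ge0..].
apply: eq_esum => e Ee; rewrite -EFinD; congr ((_ + _)%:E).
have Ve := basis_sub (basisP dot_norm hV) Ee.
rewrite /sq_image; have -> : frame_vec ((e, true) : frame_index (basis_frame hV)) = mul_i (into hV e).
  by apply: out_inj; rewrite out_mul_i (out_basis_vec dot_norm hV (basisP dot_norm hV) true Ee) intoK.
by rewrite fi mul_i_isometry.
Qed.

Lemma op_fun_is_hs K : bounded_operator V W K -> (hs_norm dot V W K < +oo)%E ->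
  @is_hs R (basis_frame hV) (basis_frame hW) (@op_fun R H dot dot_norm V W hV hW K).
Proof.
move=> bK; rewrite /hs_norm (trace_adjoint dot_norm hV hW bK) => fin.
split; [exact: op_fun_linear|exact: op_fun_bdd|split; first exact: sq_image_ge0].
have -> := esum_sq_image (@op_fun_i R H dot dot_norm V W hV hW K bK).
move: fin; set t := \esum_(_ in _) _ => fin.
have : (0 <= t)%E by apply: esum_ge0 => e _; rewrite lee_fin ip_ge0.
move: fin; case: t => [r _ _|/=|//]; first by rewrite -EFinD ltry.
by rewrite invr_eq0 pnatr_eq0 ltxx.
Qed.

Lemma hs_norm_op K (X : hs_space (basis_frame hV) (basis_frame hW)) : bounded_operator V W K ->
  (forall x, hs_fun X x = @op_fun R H dot dot_norm V W hV hW K x) ->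
  hs_norm dot V W K = (Num.sqrt (ip X X / 2))%:E.
Proof.
move=> bK XK; rewrite /hs_norm (trace_adjoint dot_norm hV hW bK).
have XK' : hs_fun X = @op_fun R H dot dot_norm V W hV hW K by apply: funext.
have := esum_rsum (hs_finsum X); rewrite -[rsum _ _]hs_normE XK'.
have -> := esum_sq_image (@op_fun_i R H dot dot_norm V W hV hW K bK).
set t := \esum_(_ in _) _; have t0 : (0 <= t)%E by apply: esum_ge0 => e _; rewrite lee_fin ip_ge0.
move: t t0 => [r|//|//] r0 [e]; rewrite lee_fin in r0.
have -> : ip X X / 2 = r by rewrite -[ip X X]/(hs_ip X X) -e; field.
by rewrite poweR_EFin powR12_sqrt.
Qed.

End HilbertSchmidtNorm.

Lemma closure_approx (S : set H) x :
  (forall e : R, 0 < e -> exists2 z, S z & Num.sqrt (rdot (z - x) (z - x)) <= e) ->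
  closure S x.
Proof.
move=> h; apply: (closed_approx dot_norm); first exact: closed_closure.
by move=> e /h[z Sz zx]; exists z => //; exact: subset_closure.
Qed.

Section PositiveDefinite.
Variables (V : set H) (hV : closed_subspace V) (A : set (H * H)).
Hypothesis pA : positive_definite dot V A.

Let sA : selfadjoint dot V A := pA.1.
Let lA : linear_operator V V A := let: And3 l _ _ := sA in l.

Lemma posdef_sub x y : A (x, y) -> V x /\ V y.
Proof. by case: lA => h _ _ /h. Qed.

Lemma posdef_fun x y z : A (x, y) -> A (x, z) -> y = z.
Proof. by case: lA => _ _; apply. Qed.

Lemma posdef_adj x y : V x -> V y -> (forall u v, A (u, v) -> dot v x = dot u y) -> A (x, y).
Proof. by move=> Vx Vy h; case: sA => _ _ <-. Qed.

Lemma posdef_sym x y u v : A (x, y) -> A (u, v) -> dot v x = dot u y.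
Proof. by move=> + Auv; case: sA => _ _ {1}<- [_ _]; apply. Qed.

Lemma posdef_lower : exists2 c : R, 0 < c & forall x y, A (x, y) -> c * rdot x x <= rdot y x.
Proof.
have [c c0 hc] := pA.2; exists c => // x y Axy.
have dx : domain A x by exists (x, y).
have Ay : app A x = y by apply: app_eq => // z Az; exact: posdef_fun Az Axy.
have := hc x dx; rewrite Ay -dot_norm lecE => /andP[_].
by rewrite -(rdotZl dot c x x) /real_dot dotZl.
Qed.

Lemma posdef_inj x x' y : A (x, y) -> A (x', y) -> x = x'.
Proof.
have [c c0 hc] := posdef_lower => A1 A2.
have := linear_operatorP (-1) lA A2 A1; rewrite !scaleN1r addNr addrC => /hc.
have -> : rdot 0 (x - x') = 0 by rewrite -(scale0r 0) /real_dot dotZl mul0r.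
rewrite pmulr_rle0// => h; apply/eqP; rewrite -subr_eq0; apply/eqP.
by apply: (rdot_eq0 dot_norm); apply/eqP; rewrite eq_le h rdot_ge0.
Qed.

(** The functional [A x |-> <x, y>] is bounded because [A] is bounded below;
    a vector [T] that represents it is in the domain of the adjoint, which is
    [A], with image [y]. *)
Lemma posdef_onto y : V y -> exists x, A (x, y).
Proof.
move=> Vy; have [c c0 hc] := posdef_lower.
have A0 : A 0 by case: lA => _ [/set_mem].
have AP (d : R) (p q : realified (H * H)%type) : A p -> A q -> A (d *: p + q).
  by case: p q => [x x'] [z z']; move=> h1 h2; exact: (linear_operatorP (d%:C%C) lA h1 h2).
pose gA := @Subspace R (realified (H * H)%type) A A0 AP.
pose D (p : sub_type gA) : cspace hV := into hV (sub_val p).2.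
have DE (p : sub_type gA) : out (D p) = (sub_val p).2.
  by case: p => -[x z] Axz; rewrite intoK//; case: (posdef_sub Axz).
have [||||T [_ T2 _]] := @riesz _ (sub_type gA) (cspace hV) D
  (fun p => rdot (sub_val p).1 y) (Num.sqrt (rdot y y) / c).
- by move=> d p q; apply: out_inj; rewrite outD outZ !DE.
- by move=> d p q; exact: rdotPl.
- by rewrite divr_ge0// ltW.
- move=> p; have [Vx Vz] : V (sub_val p).1 /\ V (sub_val p).2.
    by case: p => -[x z] Axz; exact: posdef_sub Axz.
  set X := into hV (sub_val p).1; have oX : out X = (sub_val p).1 by rewrite intoK.
  have -> : rdot (sub_val p).1 y = ip X (into hV y) by rewrite ip_out oX intoK.
  have -> : Num.sqrt (rdot y y) = hnorm (into hV y) by rewrite /hnorm ip_out intoK.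
  rewrite (le_trans (cauchy_schwarz _ _))// mulrC -mulrA ler_wpM2l ?hnorm_ge0//.
  rewrite ler_pdivlMl//; have [/eqP ->|n0] := boolP (hnorm X == 0); first by rewrite mulr0 hnorm_ge0.
  have p0 : 0 < hnorm X by rewrite lt_def n0 hnorm_ge0.
  rewrite -(ler_pM2r p0) -mulrA -expr2 sqr_hnorm (le_trans _ (ip_le_hnorm _ _))// !ip_out DE oX.
  by apply: hc; case: p {X oX DE Vx Vz n0 p0} => -[].
exists (out T); apply: posdef_adj => //; first exact: outP.
move=> u v Auv.
have real u' v' : A (u', v') -> rdot v' (out T) = rdot u' y.
  by move=> Auv'; have := T2 (@Sub _ _ gA (u', v') Auv'); rewrite ip_out DE.
rewrite !(dotE dot) !(rdot_ir dot) (real _ _ Auv); congr (_ +i* - _)%C.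
apply: real; have := linear_operatorP 'i%C lA Auv A0.
by rewrite !addr0.
Qed.

Lemma posdef_inverse : exists a : cspace hV -> cspace hV,
  [/\ bselfadj a, forall x, 0 <= ip (a x) x, forall y, A (out (a y), out y)
    & forall x, a (mul_i x) = mul_i (a x)].
Proof.
have /choice[a aP] : forall y : cspace hV, exists x : cspace hV, A (out x, out y).
  move=> y; have [x Axy] := posdef_onto (outP y).
  by exists (into hV x); rewrite intoK//; case: (posdef_sub Axy).
have [c c0 hc] := posdef_lower.
have low y : c * ip (a y) (a y) <= ip (a y) y.
  by rewrite (ipC (a y) y); exact: hc (aP y).
exists a; split=> //.
- split.
    by move=> x y; rewrite !ip_out /real_dot (posdef_sym (aP y) (aP x)).
  exists c^-1 => [|y]; first by rewrite invr_ge0 ltW.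
  rewrite ler_pdivlMl//; have [/eqP ->|n0] := boolP (hnorm (a y) == 0); first by rewrite mulr0 hnorm_ge0.
  have p0 : 0 < hnorm (a y) by rewrite lt_def n0 hnorm_ge0.
  rewrite -(ler_pM2l p0); have := low y; rewrite -sqr_hnorm; have := ip_le_hnorm (a y) y; lra.
- by move=> x; apply: le_trans (low x); rewrite mulr_ge0 ?ip_ge0// ltW.
- move=> x; apply: out_inj; apply: (posdef_inj (aP _)); rewrite !out_mul_i.
  have A0 : A (0, 0) by case: lA => _ [/set_mem].
  by have := linear_operatorP 'i%C lA (aP x) A0; rewrite !addr0.
Qed.

(** The relational inverse of the root [s] of the bounded inverse [a].  Its
    domain, the range of [s], is dense because [s] is injective. *)
Lemma is_square_root_ex : exists S, is_square_root dot V A S.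
Proof.
have [a [sa pa aA ai]] := posdef_inverse.
have [s [ss ps s2 sq]] := sqrt_ex sa pa.
have sl := bselfadj_linear ss.
have si x : s (mul_i x) = mul_i (s x).
  have ia : commutes (@mul_i _ _ _ dot_norm V hV) a by move=> z; rewrite ai.
  by have := sq _ (@mul_i_linear _ _ _ dot_norm _ hV) (@mul_i_bdd _ _ _ dot_norm _ hV) ia x.
have a_inj y : a y = 0 -> y = 0.
  move=> ay; apply: out_inj; rewrite out0; have := aA y; rewrite ay out0 => A0y.
  by apply: posdef_fun A0y _; case: lA => _ [/set_mem].
have s_inj y z : s y = s z -> y = z.
  move=> e; apply/eqP; rewrite -subr_eq0; apply/eqP/a_inj.
  by rewrite -s2 (linB sl) e subrr (lin0 sl).
have sdot x y : dot (out (s x)) (out y) = dot (out x) (out (s y)).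
  by apply: (dot_adjoint si) => z; rewrite -!ip_out ss.1.
pose S := [set p : H * H | exists y : cspace hV, p = (out (s y), out y)].
have Sapp y : app S (out (s y)) = out y.
  apply: app_eq; last by exists y.
  by move=> z [y' [/out_inj/s_inj <- ->]].
exists S; split; first split.
- split; first by move=> _ [y ->]; split; exact: outP.
    split; first by apply: mem_set; exists 0; rewrite (lin0 sl) !out0.
    move=> c _ _ /set_mem[x ->] /set_mem[y ->]; apply: mem_set.
    exists (into hV (c *: out x) + y); rewrite (linD sl) !outD (complex_linear sl si) intoK//.
    by apply: closed_subspaceZ => //; exact: outP.
  by move=> x _ _ [y [-> ->]] [z [/out_inj/s_inj <- ->]].
- move=> x Vx; apply: closure_approx => e e0.
  have [|||T [_ T2 T3]] := @riesz _ (cspace hV) (cspace hV) s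
    (fun z => ip (s z) (into hV x)) (hnorm (into hV x)) sl.
  + by move=> d p q; rewrite sl !ipE.
  + exact: hnorm_ge0.
  + by move=> z; rewrite mulrC; exact: cauchy_schwarz.
  have Tx : T = into hV x.
    apply/eqP; rewrite -subr_eq0; apply/eqP/a_inj; rewrite -s2.
    suff -> : s (T - into hV x) = 0 by rewrite (lin0 sl).
    by apply: ip_inj => z; rewrite ss.1 ip0l ipBl (ipC T) T2 (ipC (into hV x)) subrr.
  have [z hz] := T3 e e0; exists (out (s z)); first by exists (out (s z), out z) => //; exists z.
  by move: hz; rewrite Tx /hnorm ip_out [out (_ - _)]/(out (s z) - out (into hV x)) intoK.
- apply/seteqP; split=> [[p1 p2] [/= V1 V2 h]|_ [y ->]].
    have e : p1 = out (s (into hV p2)).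
      apply/eqP; rewrite -subr_eq0; apply/eqP; apply: (rdot_orth0 dot_norm hV).
        by rewrite addrC -scaleN1r; apply: closed_subspaceP => //; exact: outP.
      move=> z Vz; rewrite rdotBr /real_dot.
      have Sz : S (out (s (into hV z)), out (into hV z)) by exists (into hV z).
      have := h _ _ Sz; rewrite intoK// => ->.
      by rewrite -{2}(intoK dot_norm hV Vz) -sdot intoK// subrr.
    by exists (into hV p2); rewrite e intoK.
  split; [exact: outP|exact: outP|].
  by move=> _ _ [x [-> ->]] /=; rewrite sdot.
- move=> _ [[_ _] [y [-> ->]] /= <-]; rewrite Sapp dotE lecE /=.
  have := ps y; rewrite ipC ip_out => ->; rewrite andbT.
  have : dot (out y) (out (s y)) = conjc (dot (out y) (out (s y))) by rewrite -dotC sdot.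
  rewrite {1}dotE => /(congr1 (@complex.Im R)) /=; rewrite dotE /= => h.
  by apply/eqP; lra.
- apply/seteqP; split=> [[x z] [w [y [-> ->]] [y' [/out_inj -> ->]]] /=|[x z] Axz].
    by rewrite s2; exact: aA.
  have [/= Vx Vz] := posdef_sub Axz; exists (out (s (into hV z))).
    exists (s (into hV z)); rewrite s2; congr (_, _).
    by apply: posdef_inj Axz _; have := aA (into hV z); rewrite intoK.
  by exists (into hV z); rewrite intoK.
Qed.

(** Whatever root [S] is chosen, it is injective and onto because [A] is; its
    inverse [b] is symmetric and everywhere defined, and the identity
    [|b y|^2 = ip (a y) y] with [a = b b = A^-1] makes it bounded. *)
Lemma sqrt_op_inverse : exists b : cspace hV -> cspace hV,
  [/\ bselfadj b, forall x, b (mul_i x) = mul_i (b x), forall x, b x = 0 -> x = 0,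
      forall x y, sqrt_op dot V A (x, y) <-> exists z, x = out (b z) /\ y = out z
    & forall y, A (out (b (b y)), out y)].
Proof.
set S := sqrt_op dot V A.
have [[[SV Sl Su] _ Sadj] _ SS] : is_square_root dot V A S.
  exact: (@xgetPex _ set0 [set S | is_square_root dot V A S] is_square_root_ex).
have lS : linear_operator V V S by [].
have S0 : S (0, 0) by have [/set_mem] := Sl.
have A0 : A (0, 0) by case: lA => _ [/set_mem].
have Sinj0 x : S (x, 0) -> x = 0.
  by move=> Sx; apply: (@posdef_inj _ _ 0) A0; rewrite -SS; exists 0.
have Sinj x x' y : S (x, y) -> S (x', y) -> x = x'.
  move=> h1 h2; apply/eqP; rewrite -subr_eq0 addrC; apply/eqP/Sinj0.
  by have := linear_operatorP (-1) lS h2 h1; rewrite !scaleN1r addNr.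
have /choice[b bP] : forall y : cspace hV, exists x : cspace hV, S (out x, out y).
  move=> y; have [x] := posdef_onto (outP y); rewrite -SS => -[w _ Swy].
  by exists (into hV w); rewrite intoK//; have [] := SV _ Swy.
have Ab y : A (out (b (b y)), out y) by rewrite -SS; exists (out (b y)); exact: bP.
have bsym x y : ip (b x) y = ip x (b y).
  have [_ _ h] : adjoint dot V V S (out (b y), out y) by rewrite Sadj; exact: bP.
  by rewrite !ip_out /real_dot -(h _ _ (bP x)).
have [a [[_ [k k0 ak]] _ aA _]] := posdef_inverse.
have bb y : b (b y) = a y by apply: out_inj; exact: posdef_inj (Ab y) (aA y).
exists b; split=> //.
- split=> //; exists (Num.sqrt k) => [|y]; first exact: sqrtr_ge0.
  rewrite hnorm_le ?mulr_ge0 ?sqrtr_ge0 ?hnorm_ge0// exprMn sqr_sqrtr// bsym bb.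
  by have := ip_le_hnorm y (a y); have := ak y; have := hnorm_ge0 y; nra.
- move=> x; apply: out_inj; apply: Sinj (bP _) _; rewrite !out_mul_i.
  by have := linear_operatorP 'i%C lS (bP x) S0; rewrite !addr0.
- move=> x bx; apply: out_inj; have := bP x; rewrite bx out0 => h.
  exact: Su h S0.
- move=> x y; split=> [Sxy|[z [-> ->]]//].
  have [Vx Vy] := SV _ Sxy; exists (into hV y); rewrite intoK//; split=> //.
  by apply: Sinj Sxy _; have := bP (into hV y); rewrite intoK.
Qed.

(** With [a = b b = A^-1] one has [(A - 1/l) (a y) = - (a y - l y) / l], so a
    bounded inverse of [A - 1/l] would bound [a - l] from below. *)
Lemma approx_eigenvalue_spectrum (b : cspace hV -> cspace hV) l :
  (forall y, A (out (b (b y)), out y)) -> 0 < l -> approx_eigenvalue (b \o b) l ->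
  spectrum V A (l^-1)%:C%C.
Proof.
move=> Ab l0 al [[_ _ Ku] _ [c hc]].
have A0 : A (0, 0) by case: lA => _ [/set_mem].
set K := ((Defs.shift A _)^-1)%relation in Ku hc.
have Kb y : K (out (- l^-1 *: (b (b y) - l *: y)), out (b (b y))).
  rewrite /K /Defs.shift /= (_ : _ + _ = out y); first exact: Ab.
  transitivity (out (- l^-1 *: (b (b y) - l *: y) + l^-1 *: b (b y))); first by [].
  congr out.
  by apply: ip_inj => w; rewrite !ipE; field; rewrite gt_eqF.
pose k := `|c| * l^-1 + 1.
have k0 : 0 < k by rewrite ltr_wpDl// mulr_ge0// invr_ge0 ltW.
have low y : l * hnorm y <= k * hnorm (b (b y) - l *: y).
  set d := b (b y) - l *: y.
  have h1 : hnorm (b (b y)) <= `|c| * (l^-1 * hnorm d).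
    have := hc _ (outP (- l^-1 *: d)).
    have -> : app K (out (- l^-1 *: d)) = out (b (b y)).
      by apply: app_eq (Kb y) => z Kz; exact: Ku Kz (Kb y).
    rewrite norm_real (norm_real (out (_ *: _))) -rmorphM lecR -!(sqrt_rdot dot_norm).
    rewrite -!ip_out -!/(hnorm _) hnormZ normrN gtr0_norm ?invr_gt0// => /le_trans; apply.
    by rewrite ler_wpM2r ?ler_norm// mulr_ge0 ?hnorm_ge0// invr_ge0 ltW.
  have := hnormB_le (b (b y)) d; rewrite {1}/d opprB addrC subrK hnormZ gtr0_norm// /k.
  by lra.
have e0 : 0 < l / (2 * k) by rewrite divr_gt0// mulr_gt0.
have [y yn hy] := al _ e0.
have := low y; have := ler_wpM2l (ltW k0) hy.
have -> : k * (l / (2 * k) * hnorm y) = l * hnorm y / 2 by field; rewrite gt_eqF.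
move=> h1 h2; apply: yn; apply: hnorm_eq0; have := hnorm_ge0 y.
by move: h1 h2; rewrite /=; set u := hnorm y; nra.
Qed.

End PositiveDefinite.
End UnboundedOperators.

(** * The equation for the original operators *)

Section WeakEquation.
Context {R : realType} {H : completeNormedModType R[i]}.
Variable dot : {dot H for Num.conj}.
Hypothesis dot_norm : forall x : H, dot x x = `|x| ^+ 2.
Local Notation rdot := (real_dot dot).
Local Notation cspace := (closed_space dot_norm).
Local Notation into := (to_closed_space dot_norm).

Section Root.
Variables (V : set H) (hV : closed_subspace V) (S : set (H * H)) (b : cspace hV -> cspace hV).
Hypotheses (sb : bselfadj b) (b_inj : forall x, b x = 0 -> x = 0).
Hypothesis Sb : forall x y, S (x, y) <-> exists z, x = out (b z) /\ y = out z.

Lemma root_injective x y : b x = b y -> x = y.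
Proof.
by move=> e; apply/eqP; rewrite -subr_eq0 -(b_inj (_ : b (x - y) = 0))// (linB (bselfadj_linear sb)) e subrr.
Qed.

Lemma root_domain v : domain S v <-> exists w, v = out (b w).
Proof.
split=> [[[x y] /Sb[z [-> _]] <-]|[w ->]]; first by exists z.
by exists (out (b w), out w) => //; apply/Sb; exists w.
Qed.

Lemma root_app w : app S (out (b w)) = out w.
Proof.
apply: app_eq; last by apply/Sb; exists w.
by move=> z /Sb[z' [/out_inj/root_injective -> ->]].
Qed.

Lemma root_inv_app w : app (S^-1)%relation (out w) = out (b w).
Proof.
apply: app_eq; last by rewrite /=; apply/Sb; exists w.
by move=> z /= /Sb[z' [-> /out_inj ->]].
Qed.

Lemma approx_eigenvalue_sqr_ge0 l : approx_eigenvalue (b \o b) l -> 0 <= l.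
Proof.
move=> al; rewrite leNgt; apply/negP => l0; have e0 : 0 < - l / 2 by lra.
have [y yn hy] := al _ e0; apply: yn; apply: hnorm_eq0.
have h1 := ip_le_hnorm (b (b y) - l *: y) y; rewrite ipBl sb.1 ipZl -(sqr_hnorm y) in h1.
have h2 := ler_wpM2r (hnorm_ge0 y) hy; rewrite /= in h2.
have h3 := ip_ge0 (b y); have h4 := hnorm_ge0 y.
have : - l * hnorm y ^+ 2 <= - l / 2 * hnorm y ^+ 2 by lra.
move=> h5; apply/eqP; rewrite -sqrf_eq0 eq_le sqr_ge0 andbT -(ler_pM2l e0) mulr0; lra.
Qed.

End Root.

(** Substituting [v = b w] and [u = n u'], where [b] and [n] are the inverses
    of the two roots, removes every unbounded operator from the equation. *)
Lemma weak_equation V W (hV : closed_subspace V) (hW : closed_subspace W)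
    (SA SM T F : set (H * H)) (b : cspace hW -> cspace hW) (n : cspace hV -> cspace hV) :
  bselfadj b -> (forall x, b x = 0 -> x = 0) -> (forall x, b (mul_i x) = mul_i (b x)) ->
  (forall x y, SA (x, y) <-> exists z, x = out (b z) /\ y = out z) ->
  bselfadj n -> (forall x, n x = 0 -> x = 0) ->
  (forall x y, SM (x, y) <-> exists z, x = out (n z) /\ y = out z) ->
  bounded_operator V W T -> bounded_operator V W F ->
  (forall v u, domain SA v -> domain SM u ->
     dot (app SA v) (app T (app (SM^-1)%relation u))
      - dot v (app (SA^-1)%relation (app T (app SM u))) = dot v (app F u)) <->
  (forall u, op_fun hW T (n (n u)) - b (b (op_fun hW T u)) = b (op_fun hW F (n u)) :> cspace hW).
Proof.
move=> sb b0 bi Sb sn n0 Sn bT bF.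
have bdot x y : dot (out (b x)) (out y) = dot (out x) (out (b y)).
  by apply: (dot_adjoint bi) => z; rewrite -!ip_out sb.1.
have key w u :
    dot (app SA (out (b w))) (app T (app (SM^-1)%relation (out (n u))))
      - dot (out (b w)) (app (SA^-1)%relation (app T (app SM (out (n u)))))
    = dot (out w) (out (op_fun hW T (n (n u)) - b (b (op_fun hW T u)))) /\
    dot (out (b w)) (app F (out (n u))) = dot (out w) (out (b (op_fun hW F (n u)))).
  rewrite (root_app sb b0 Sb) (root_inv_app Sn) (root_app sn n0 Sn).
  rewrite -!(op_funE hW bT) -(op_funE hW bF) (root_inv_app Sb) !bdot outD outN.
  by split=> //; rewrite linearDr linearNr.
split=> [h u|h v u /(root_domain Sb)[w ->] /(root_domain Sn)[u' ->]]; last first.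
  by have [-> ->] := key w u'; rewrite h.
apply: ip_inj => w; rewrite ipC [RHS]ipC !ip_out /real_dot; congr complex.Re.
have [<- <-] := key w u.
by apply: h; [apply/(root_domain Sb); exists w|apply/(root_domain Sn); exists u].
Qed.

Section ComplexLinearSolutions.
Variables (V W : set H) (hV : closed_subspace V) (hW : closed_subspace W).
Local Notation VF := (basis_frame dot_norm hV).
Local Notation WF := (basis_frame dot_norm hW).

Lemma is_hs_comp_i (X : hs_space VF WF) : @is_hs R VF WF (hs_fun X \o @mul_i _ _ _ dot_norm _ hV).
Proof.
have Xl := hs_linear X; split.
- by move=> c x y /=; rewrite mul_i_linear Xl.
- exact: bdd_comp (hs_bdd X) (mul_i_bdd _ _).
split; first exact: sq_image_ge0.
have [_] := hs_finsum X; rewrite !esum_basis => [|p|p]; [|exact: ip_ge0..].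
congr (_ < _)%E; apply: eq_esum => e Ee; rewrite addrC.
have e1 : frame_vec ((e, true) : frame_index VF) = mul_i (frame_vec ((e, false) : frame_index VF)).
  have hE := basisP dot_norm hV.
  by apply: out_inj; rewrite out_mul_i (out_basis_vec dot_norm hV hE true Ee)
    (out_basis_vec dot_norm hV hE false Ee).
rewrite /sq_image e1 [(hs_fun X \o _) _]/= [(hs_fun X \o _) (mul_i _)]/= mul_i_sqr; congr (_ + _)%:E.
by rewrite (linN Xl) ipNl ipNr opprK.
Qed.

Lemma is_hs_i_comp (X : hs_space VF WF) : @is_hs R VF WF (@mul_i _ _ _ dot_norm _ hW \o hs_fun X).
Proof.
have [f0 fX] := hs_finsum X; split.
- by move=> c x y /=; rewrite hs_linear mul_i_linear.
- exact: bdd_comp (mul_i_bdd _ _) (hs_bdd X).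
split; first exact: sq_image_ge0.
by move: fX; congr (_ < _)%E; apply: eq_esum => p _; congr EFin; exact/esym/mul_i_isometry.
Qed.

(** [T (i u)] and [i (T u)] define solutions that differ by [i] alone, so
    their difference solves the homogeneous equation; this makes the real
    solution [T] complex-linear. *)
Lemma sylvester_commutes_i (b : cspace hW -> cspace hW) (n : cspace hV -> cspace hV)
    (F : cspace hV -> cspace hW) (T : hs_space VF WF) :
  linear b -> (forall x, b (mul_i x) = mul_i (b x)) ->
  (forall x, n (mul_i x) = mul_i (n x)) -> (forall x, F (mul_i x) = mul_i (F x)) ->
  (forall X : hs_space VF WF, (forall u, hs_fun X (n (n u)) = b (b (hs_fun X u))) -> X = 0) ->
  (forall u, hs_fun T (n (n u)) - b (b (hs_fun T u)) = b (F (n u))) ->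
  forall u, hs_fun T (mul_i u) = mul_i (hs_fun T u).
Proof.
move=> bl bi ni Fi inj sol u.
pose X1 : hs_space VF WF := @Sub _ _ (hs_subspace VF WF) _ (is_hs_comp_i T).
pose X2 : hs_space VF WF := @Sub _ _ (hs_subspace VF WF) _ (is_hs_i_comp T).
have sol' y : hs_fun T (n (n y)) = b (F (n y)) + b (b (hs_fun T y)).
  by rewrite -sol subrK.
have X0 : X1 - X2 = 0.
  apply: inj => y.
  have -> z : hs_fun (X1 - X2) z = hs_fun T (mul_i z) - mul_i (hs_fun T z) by [].
  rewrite -!ni !sol' !ni Fi bi (linD (@mul_i_linear _ _ _ dot_norm _ hW)) !(linB bl) -!bi.
  by rewrite opprD addrACA subrr add0r.
have := congr1 (fun X : hs_space VF WF => hs_fun X u) X0; rewrite /hs_fun /=.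
by move=> /eqP; rewrite subr_eq0 => /eqP.
Qed.

End ComplexLinearSolutions.

(** The relative distance is invariant under inversion, so the gap between
    the spectra of [M] and [A] controls the approximate eigenvalues of
    [n n = M^-1] and [b b = A^-1]. *)
Lemma gap_condition V W (hV : closed_subspace V) (hW : closed_subspace W)
    (A M : set (H * H)) (b : cspace hW -> cspace hW) (n : cspace hV -> cspace hV) (g : R) :
  positive_definite dot W A -> positive_definite dot V M -> bselfadj b -> bselfadj n ->
  (forall y, A (out (b (b y)), out y)) -> (forall y, M (out (n (n y)), out y)) ->
  0 < g -> (g%:E <= gap (spectrum V M) (spectrum W A))%E ->
  forall l r, approx_eigenvalue (b \o b) l -> approx_eigenvalue (n \o n) r ->
    g ^+ 2 * (l * r) <= (r - l) ^+ 2.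
Proof.
move=> pA pM sb sn Ab Mn g0 gle l r al ar.
have l0 := approx_eigenvalue_sqr_ge0 sb al; have r0 := approx_eigenvalue_sqr_ge0 sn ar.
have [->|ln] := eqVneq l 0; first by rewrite mul0r mulr0 sqr_ge0.
have [->|rn] := eqVneq r 0; first by rewrite !mulr0 sqr_ge0.
have lp : 0 < l by rewrite lt_def ln. have rp : 0 < r by rewrite lt_def rn.
have sA := approx_eigenvalue_spectrum pA Ab lp al.
have sM := approx_eigenvalue_spectrum pM Mn rp ar.
have : (g%:E <= (`|r^-1 - l^-1| / Num.sqrt (r^-1 * l^-1))%:E)%E.
  by apply: le_trans gle _; apply: ereal_inf_lbound; exists r^-1, l^-1.
have q0 : 0 < r^-1 * l^-1 by rewrite mulr_gt0 ?invr_gt0.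
rewrite lee_fin ler_pdivlMr ?sqrtr_gt0// -ler_sqr ?nnegrE ?mulr_ge0 ?sqrtr_ge0 ?(ltW g0)//.
rewrite exprMn sqr_sqrtr ?(ltW q0)// real_normK ?num_real// => h.
have p0 : 0 <= (l * r) ^+ 2 by exact: sqr_ge0.
have := ler_wpM2r p0 h.
have -> : g ^+ 2 * (r^-1 * l^-1) * (l * r) ^+ 2 = g ^+ 2 * (l * r) by field; rewrite ln rn.
have -> : (r^-1 - l^-1) ^+ 2 * (l * r) ^+ 2 = (r - l) ^+ 2 by field; rewrite ln rn.
exact.
Qed.

End WeakEquation.

Theorem theorem2p7 (R : realType) (H : completeNormedModType R[i])
    (dot : {dot H for Num.conj})
    (dot_norm : forall x : H, dot x x = `|x| ^+ 2)
    (separableH : separable H)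
    (HA HM : set H)
    (HA_closed : closed_subspace HA) (HM_closed : closed_subspace HM)
    (A M F : set (H * H))
    (A_posdef : positive_definite dot HA A)
    (M_posdef : positive_definite dot HM M)
    (F_bounded : bounded_operator HM HA F)
    (F_hs : (hs_norm dot HM HA F < +oo)%E)
    (gap_gt0 : (0 < gap (spectrum HM M) (spectrum HA A))%E) :
  let A12 := sqrt_op dot HA A in
  let M12 := sqrt_op dot HM M in
  let solution T := hilbert_schmidt dot HM HA T /\
    forall v u : H, domain A12 v -> domain M12 u ->
      dot (app A12 v) (app T (app (M12^-1)%relation u))
      - dot v (app (A12^-1)%relation (app T (app M12 u)))
      = dot v (app F u) in
  exists T : set (H * H), unique solution T /\
    (hs_norm dot HM HA T
       <= hs_norm dot HM HA F / gap (spectrum HM M) (spectrum HA A))%E.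
Proof.
move=> A12 M12 solution.
have [b [sb bi b0 Sb Ab]] := sqrt_op_inverse dot_norm HA_closed A_posdef.
have [n [sn ni n0 Sn Mn]] := sqrt_op_inverse dot_norm HM_closed M_posdef.
pose VF := basis_frame dot_norm HM_closed; pose WF := basis_frame dot_norm HA_closed.
pose opf := @op_fun R H dot dot_norm HM HA HM_closed HA_closed.
pose hsop K (hK : @is_hs R VF WF (opf K)) : hs_space VF WF := @Sub _ _ (hs_subspace VF WF) _ hK.
have hsF := op_fun_is_hs dot_norm HM_closed HA_closed F_bounded F_hs.
pose FX := hsop F hsF.
set G := gap _ _ in gap_gt0 *.
have valid (g : R) : 0 < g -> (g%:E <= G)%E -> forall l r,
    approx_eigenvalue (b \o b) l -> approx_eigenvalue (n \o n) r ->
    g ^+ 2 * (l * r) <= (r - l) ^+ 2.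
  by move=> g0 gG; exact: gap_condition A_posdef M_posdef sb sn Ab Mn g0 gG.
(* The theory takes a finite [g]; every one below the gap gives the same
   solution [T]. *)
have [g g0 gG] : exists2 g : R, 0 < g & (g%:E <= G)%E.
  move: gap_gt0; case: G {valid} => [r|_|//]; last by exists 1 => //; rewrite leey.
  by rewrite lte_fin => r0; exists r.
have inj (X : hs_space VF WF) : (forall u, hs_fun X (n (n u)) = b (b (hs_fun X u))) -> X = 0.
  exact: (@sylvester_inj R VF WF n b g sn sb n0 b0 g0 (valid g g0 gG)).
have uniq (X Y : hs_space VF WF) :
    (forall u, hs_fun X (n (n u)) - b (b (hs_fun X u)) = b (opf F (n u))) ->
    (forall u, hs_fun Y (n (n u)) - b (b (hs_fun Y u)) = b (opf F (n u))) -> X = Y.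
  move=> sX sY; apply/eqP; rewrite -subr_eq0; apply/eqP/inj => u.
  have -> z : hs_fun (X - Y) z = hs_fun X z - hs_fun Y z by [].
  rewrite !(linB (bselfadj_linear sb)) -[hs_fun X (n (n u))](subrK (b (b (hs_fun X u)))).
  rewrite -[hs_fun Y (n (n u))](subrK (b (b (hs_fun Y u)))) sX sY.
  by rewrite opprD addrACA subrr add0r.
have [T _ Tsol] := @sylvester_ex R VF WF n b g sn sb g0 (valid g g0 gG) FX.
have Tbound (h : R) : 0 < h -> (h%:E <= G)%E -> hnorm T <= hnorm FX / h.
  move=> h0 hG; have [T' T'h T'sol] := @sylvester_ex R VF WF n b h sn sb h0 (valid h h0 hG) FX.
  by rewrite (uniq T T').
have Ti := sylvester_commutes_i (bselfadj_linear sb) bi ni (op_fun_i HA_closed F_bounded) inj Tsol.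
pose TG := graph_of (hs_fun T).
have bTG : bounded_operator HM HA TG.
  exact: graph_of_bounded (hs_linear T) (hs_bdd T) Ti.
have TGE x : opf TG x = hs_fun T x := op_fun_graph (hs_linear T) (hs_bdd T) Ti x.
have TGnorm : hs_norm dot HM HA TG = (Num.sqrt (ip T T / 2))%:E.
  by apply: (hs_norm_op bTG) => x; rewrite -TGE.
have Fnorm : hs_norm dot HM HA F = (Num.sqrt (ip FX FX / 2))%:E.
  exact: (hs_norm_op F_bounded).
have eqT K (bK : bounded_operator HM HA K) := weak_equation sb b0 bi Sb sn n0 Sn bK F_bounded.
exists TG; split; first split.
- split; first by split=> //; rewrite TGnorm ltry.
  by apply/(eqT _ bTG) => u; have := Tsol u; rewrite -!TGE.
- move=> K [[bK hK] /(eqT _ bK) solK].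
  have hsK := op_fun_is_hs dot_norm HM_closed HA_closed bK hK.
  pose KX := hsop K hsK.
  have TK : T = KX by apply: uniq => // u; exact: solK.
  by rewrite /TG TK; exact: (graph_op_fun dot_norm HM_closed HA_closed bK).
have sqrt2 (X : hs_space VF WF) : Num.sqrt (ip X X / 2) = hnorm X / Num.sqrt 2.
  by rewrite sqrtrM ?ip_ge0// sqrtrV.
have s20 : 0 < Num.sqrt 2 :> R by rewrite sqrtr_gt0.
have bound (h : R) : 0 < h -> (h%:E <= G)%E -> Num.sqrt (ip T T / 2) <= Num.sqrt (ip FX FX / 2) / h.
  by move=> h0 hG; rewrite !sqrt2 mulrAC ler_pM2r ?invr_gt0// Tbound.
(* When the gap is infinite, the bound holds for every [h > 0] and forces the
   norm of [T] to vanish. *)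
rewrite TGnorm Fnorm; case: G gap_gt0 bound {valid gG Tbound} => [r|_|//] /=.
  rewrite lte_fin => r0 /(_ r r0 (lexx _)) h.
  by rewrite inver gt_eqF// -EFinM lee_fin.
move=> bound; rewrite invey mule0 lee_fin; apply/ler_addgt0Pr => e e0; rewrite add0r.
set f := Num.sqrt (ip FX FX / 2) in bound; have f0 : 0 <= f by exact: sqrtr_ge0.
have h0 : 0 < (f + 1) / e by rewrite divr_gt0//; lra.
apply: le_trans (bound _ h0 (leey _)) _; rewrite invf_div mulrA ler_pdivrMr; nra.
Qed.
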